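(* (a) For any thresholds $A,B>1$ and any weights $\mathbf q_0,\mathbf q_1$, $$\mathsf P_0(d_M=1)\le\frac{|\mathbf q_1|}{B},\quad \mathsf P_0(d_N=1)\le\frac{|\mathbf q_1|}{B},$$ and for every $1\le i\le K$, $$\mathsf P_i(d_M=0)\le\frac{1}{A\,q_0^i},\quad \mathsf P_i(d_N=0)\le\frac{1}{A\,q_0^i}.$$ (b) As $A,B\to\infty$, $$\mathsf P_0(d_M=1)=\frac1B\Big(\sum_{j=1}^K q_1^j\gamma_j\Big)(1+o(1)),\qquad \mathsf P_0(d_N=1)\le\frac1B\Big(\sum_{j=1}^K q_1^j\gamma_j\Big)(1+o(1)).$$ If in addition $r=1$, then for every $1\le i\le K$, as $A,B\to\infty$, $$\mathsf P_i(d_M=0)\le\frac{\gamma_0^1}{q_0^iA}(1+o(1)),\qquad \mathsf P_i(d_N=0)\le\frac{\gamma_0^1}{q_0^iA}(1+o(1)).$$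
   Context: Setup: $X_1,X_2,\dots$ are i.i.d. random vectors in $\mathbb R^d$ with common density $f$ with respect to a non-degenerate $\sigma$-finite measure $\nu$; $\mathcal F_t=\sigma(X_1,\dots,X_t)$. Let $f_0,f_1,\dots,f_K$ ($K\ge 1$) be densities with common support; $\mathsf P_j,\mathsf E_j$ denote probability and expectation when $f=f_j$, $j=0,1,\dots,K$. One tests $H_0:f=f_0$ versus $H_1:f\in\{f_1,\dots,f_K\}$. For $1\le i\le K$ let $\Lambda^i_t=\prod_{n=1}^t f_i(X_n)/f_0(X_n)$ and $Z^i_t=\log\Lambda^i_t$. Standing assumptions: for each $i$, $f_i\neq f_0$ on a set of positive $\nu$-measure; $Z^i_1$ is non-arithmetic under $\mathsf P_0$ and under $\mathsf P_i$; $I_i:=\mathsf E_i[Z^i_1]<\infty$ and $I^i_0:=\mathsf E_0[-Z^i_1]<\infty$ (both are then positive). The densities are ordered so that $I_0:=\min_{1\le i\le K}I^i_0=I^1_0=\dots=I^r_0<I^{r+1}_0\le\dots\le I^K_0$ for some integer $1\le r\le K$. Overshoot constants: for $c>0$ let $\tau^i_c=\inf\{t:Z^i_t\ge c\}$ and $\sigma^i_c=\inf\{t:Z^i_t\le -c\}$; let $\mathcal H_i(x)=\lim_{c\to\infty}\mathsf P_i(Z^i_{\tau^i_c}-c\le x)$ and $\mathcal H^i_0(x)=\lim_{c\to\infty}\mathsf P_0(|Z^i_{\sigma^i_c}+c|\le x)$, $x>0$, be the limiting overshoot distributions, and $\gamma_i=\int_0^\infty e^{-x}\mathcal H_i(dx)$,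 $\gamma^i_0=\int_0^\infty e^{-x}\mathcal H^i_0(dx)$. Tests: a weight is a vector $\mathbf q=(q^1,\dots,q^K)$ with all $q^i>0$; $|\mathbf q|=\sum_i q^i$; $\Lambda_t(\mathbf q)=\sum_{i=1}^K q^i\Lambda^i_t$, $\hat\Lambda_t(\mathbf q)=\max_{1\le i\le K}q^i\Lambda^i_t$, $Z_t(\mathbf q)=\log\Lambda_t(\mathbf q)$, $\hat Z_t(\mathbf q)=\log\hat\Lambda_t(\mathbf q)$. Given two weights $\mathbf q_0=(q_0^1,\dots,q_0^K)$, $\mathbf q_1=(q_1^1,\dots,q_1^K)$ and thresholds $A,B>1$, the Mixture Likelihood Ratio Test (MiLRT) is $M=\inf\{t:\Lambda_t(\mathbf q_1)\ge B\text{ or }\Lambda_t(\mathbf q_0)\le A^{-1}\}$, $d_M=\mathbf 1\{\Lambda_M(\mathbf q_1)\ge B\}$, and the Weighted Generalized Likelihood Ratio Test (WGLRT) is $N=\inf\{t:\hat\Lambda_t(\mathbf q_1)\ge B\text{ or }\hat\Lambda_t(\mathbf q_0)\le A^{-1}\}$, $d_N=\mathbf 1\{\hat\Lambda_N(\mathbf q_1)\ge B\}$ (decision $1$ means accept $H_1$, $0$ means accept $H_0$; the events $\{d=j\}$ are understood to include $\{T<\infty\}$). *)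

(* Defs.v *)
From HB Require Import structures.
From mathcomp Require Import all_boot all_order all_algebra.
From mathcomp Require Import all_classical all_reals all_analysis.
Set Implicit Arguments. Unset Strict Implicit. Unset Printing Implicit Defensive.
Import Order.TTheory GRing.Theory Num.Theory numFieldNormedType.Exports.
Local Open Scope classical_set_scope.
Local Open Scope ring_scope.

Definition Rd (R : realType) (d : nat) := g_sigma_algebraType (@open 'rV[R]_d).

Section Defs.
Context {R : realType} {d : nat} {dO : measure_display} {Omega : measurableType dO}.
Local Notation T := (Rd R d).

Definition is_density (nu : {measure set T -> \bar R}) (g : T -> R) : Prop :=
  (forall x, 0 <= g x) /\ measurable_fun setT g /\ (\int[nu]_x (g x)%:E = 1)%E.

(* Under P, the X_1, X_2, ... (here X 0, X 1, ...) are i.i.d. with density g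
   w.r.t. nu: every finite-dimensional distribution is the product law. *)
Definition iid_density (nu : {measure set T -> \bar R}) (P : probability Omega R)
    (X : nat -> Omega -> T) (g : T -> R) : Prop :=
  (forall n, measurable_fun setT (X n)) /\
  forall (n : nat) (Bs : nat -> set T), (forall k, measurable (Bs k)) ->
    P [set w | forall k, (k < n)%N -> Bs k (X k w)] =
      (\prod_(k < n) \int[nu]_(x in Bs k) (g x)%:E)%E.

Definition LR (f : nat -> T -> R) (X : nat -> Omega -> T) (i t : nat) (w : Omega) : R :=
  \prod_(k < t) (f i (X k w) / f 0%N (X k w)).

Definition LLR f X i t w : R := ln (LR f X i t w).

Definition wnorm (K : nat) (q : nat -> R) : R := \sum_(1 <= i < K.+1) q i.

Definition mixLR (K : nat) f X (q : nat -> R) (t : nat) (w : Omega) : R :=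
  \sum_(1 <= i < K.+1) q i * LR f X i t w.

(* hat Lambda_t(q) = max_i q^i Lambda^i_t  (all terms are >= 0) *)
Definition maxLR (K : nat) f X (q : nat -> R) (t : nat) (w : Omega) : R :=
  \big[Num.max/0]_(1 <= i < K.+1) (q i * LR f X i t w).

Definition stop_cond (U L : nat -> Omega -> R) (A B : R) (t : nat) (w : Omega) : Prop :=
  B <= U t w \/ L t w <= A^-1.

Definition stops_at U L A B (t : nat) (w : Omega) : Prop :=
  (1 <= t)%N /\ stop_cond U L A B t w /\
  forall s, (1 <= s)%N -> (s < t)%N -> ~ stop_cond U L A B s w.

Definition accept1 U L A B : set Omega :=
  [set w | exists t, stops_at U L A B t w /\ B <= U t w].
Definition accept0 U L A B : set Omega :=
  [set w | exists t, stops_at U L A B t w /\ U t w < B].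

Definition upper_overshoot_le (Z : nat -> Omega -> R) (c x : R) : set Omega :=
  [set w | exists t, c <= Z t w /\ (forall s, (s < t)%N -> Z s w < c) /\ Z t w - c <= x].

Definition lower_overshoot_le (Z : nat -> Omega -> R) (c x : R) : set Omega :=
  [set w | exists t, Z t w <= - c /\ (forall s, (s < t)%N -> - c < Z s w) /\
                     `|Z t w + c| <= x].

Definition is_limit_overshoot (P : probability Omega R) (E : R -> R -> set Omega)
    (mu : probability R R) : Prop :=
  mu `[0, +oo[%classic = 1%E /\
  forall x : R, 0 < x -> (P (E c x) @[c --> +oo] --> mu `]-oo, x]%classic).

Definition overshoot_const (mu : probability R R) : R :=
  fine (\int[mu]_(x in `[0, +oo[%classic) (expR (- x))%:E).

Definition nonarithmetic (P : probability Omega R) (Y : Omega -> R) : Prop :=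
  forall h : R, 0 < h -> (P [set w | exists k : int, Y w = (k%:~R * h)%R] < 1)%E.

Definition KL0 (P : nat -> probability Omega R) f X (i : nat) : R :=
  fine (\int[P 0%N]_w (- LLR f X i 1 w)%:E).

End Defs.

(* Main.v *)
(** Everything is reduced to comparing probabilities of one event under different
    hypotheses.  If [G t] is an event of the first [t] observations, then
    [P_i (G t) = E_0 [LR_i; G t]]; so a pointwise linear inequality between the
    [LR_i]'s, valid on each member of a disjoint sequence [G t], becomes the same
    inequality between the numbers [P_i (bigcup_t G t)].

    - Part (a) is this principle applied at the stopping time.
    - The overshoot law is only known as a limit, but the principle turns it into
      [e^c P_0 (Z^i ever exceeds c) -> gamma_i], by approximating [e^-x] with step
      functions.  This is the only renewal-theoretic input, and no continuity of the
      limit law is needed.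
    - For the mixture, let [kappa_i] be the total weight of the [j] with
      [f_j = f_i] a.e.  Then [kappa_i LR_i <= Lambda (q1)] always, and under [P_i]
      the ratio of the two sides tends to 1, because [LR_j / LR_i] has a geometrically
      decaying Hellinger moment when [f_j] and [f_i] differ.  Hence the mixture
      crosses [B] practically when some [LR_i] crosses [B / kappa_i], and
      [P_0 (d_M = 1)] is squeezed between sums of crossing probabilities.
    - If [r = 1], then [A P_1 (d = 0)] is bounded by the crossing limit of [- Z^1],
      while [A P_i (d = 0) -> 0] for [i >= 2]: at a time [n ~ log A / m] with
      [I_1 < m < I_i], the weak law under [P_0] puts [LR_1] above and [LR_i] below
      [1 / A], and stopping before or after [n] is then controlled by comparison. *)
Require Import Defs.
From HB Require Import structures.
From mathcomp Require Import all_boot all_order all_algebra.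
From mathcomp Require Import all_classical all_reals all_analysis.
From mathcomp Require Import measurable_realfun ring lra.
Import Order.TTheory GRing.Theory Num.Theory numFieldNormedType.Exports.
Local Open Scope classical_set_scope.
Local Open Scope ring_scope.
Import HBNNSimple.

(** The i.i.d. hypothesis gives the probabilities of rectangles only, and the densities may vanish
    or coincide. The events of the first [t] observations are therefore taken as the sigma-algebra
    generated by rectangles, and the change of measure is a Dynkin argument. A set of full measure
    is fixed once on which the ratios are positive and almost everywhere equal densities are equal;
    pointwise inequalities are asked only there. Alternatives may coincide with each other (only
    equality with [f 0] is excluded), so under [P_i] the mixture need not behave like [q i] times
    [LR_i]; this is why [kappa_i] appears. The lower bound for the mixture meets an obstacle: [LR_i]
    may reach its level after the test has already accepted [H_0], or has accepted [H_1] with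
    another component in the lead. Such paths are charged at the crossing time, where [LR_i] is at
    least [B / kappa_i]; their [P_0]-probability is then at most [kappa_i / B] times a
    [P_i]-probability that is small. *)

Lemma measurable_fun_inv_ge0 {R : realType} {d} {T : measurableType d} (g : T -> R) :
  (forall x, 0 <= g x) -> measurable_fun setT g ->
  measurable_fun setT (fun x => (g x)^-1).
Proof.
move=> g0 mg.
(* On nonnegative reals inversion is the power with exponent -1, also at 0, where both give 0. *)
rewrite (_ : (fun x => _) = (fun x => g x `^ (-1))); last first.
  by apply/funext => x; rewrite powR_inv1.
exact: measurableT_comp (measurable_powR _) mg.
Qed.

(** * Integrals of products over an i.i.d. sample *)

Section integral_agree.
Context {R : realType} {d d1 d2 : measure_display} {T : measurableType d}
  {T1 : measurableType d1} {T2 : measurableType d2}.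
Variables (mu1 : {measure set T1 -> \bar R}) (mu2 : {measure set T2 -> \bar R}).
Variables (V1 : T1 -> R) (V2 : T2 -> R) (Y1 : T1 -> T) (Y2 : T2 -> T) (c : R).
Hypotheses (mV1 : measurable_fun setT V1) (mV2 : measurable_fun setT V2).
Hypotheses (mY1 : measurable_fun setT Y1) (mY2 : measurable_fun setT Y2).
Hypotheses (V10 : forall x, 0 <= V1 x) (V20 : forall x, 0 <= V2 x) (c0 : 0 <= c).
Hypothesis agree : forall B, measurable B ->
  (\int[mu1]_x (V1 x * \1_B (Y1 x))%:E = c%:E * \int[mu2]_x (V2 x * \1_B (Y2 x))%:E)%E.

(** [|r|] equals [r] on the range of [h]; it makes the sign of the coefficients immediate. *)
Let nnsfun_decomp (h : {nnsfun T >-> R}) y :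
  h y = \sum_(r <- finmap.enum_fset (fset_set (range h))) `|r| * \1_(h @^-1` [set r]) y.
Proof.
rewrite [LHS]fimfunE fsbig_finite//=; apply: eq_bigr => r _.
rewrite indicE; case: (boolP (_ \in _)) => [|_]; last by rewrite !mulr0.
by rewrite inE => /= <-; rewrite ger0_norm.
Qed.

Let mind (B : set T) : measurable B -> measurable_fun setT (\1_B : T -> R).
Proof. by move=> mB; exact: measurable_indic. Qed.

Let agree_nnsfun (h : {nnsfun T >-> R}) :
  (\int[mu1]_x (V1 x * h (Y1 x))%:E = c%:E * \int[mu2]_x (V2 x * h (Y2 x))%:E)%E.
Proof.
have mh r : measurable (h @^-1` [set r]) by exact: measurable_sfunP.
have aux d' (T' : measurableType d') (mu : {measure set T' -> \bar R}) (V : T' -> R)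
    (Y : T' -> T) : measurable_fun setT V -> measurable_fun setT Y ->
    (forall x, 0 <= V x) ->
    (\int[mu]_x (V x * h (Y x))%:E =
     \sum_(r <- finmap.enum_fset (fset_set (range h)))
       `|r|%:E * \int[mu]_x (V x * \1_(h @^-1` [set r]) (Y x))%:E)%E.
  move=> mV mY V0.
  have mf r : measurable_fun setT (fun x => V x * \1_(h @^-1` [set r]) (Y x)).
    by apply: measurable_funM => //; exact: measurableT_comp (mind _ (mh r)) mY.
  have f0 r x : 0 <= V x * \1_(h @^-1` [set r]) (Y x) by rewrite mulr_ge0.
  transitivity (\int[mu]_x (\sum_(r <- finmap.enum_fset (fset_set (range h)))
       (`|r| * (V x * \1_(h @^-1` [set r]) (Y x)))%:E))%E.
    apply: eq_integral => x _; rewrite sumEFin nnsfun_decomp mulr_sumr.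
    by congr EFin; apply: eq_bigr => r _; rewrite mulrCA.
  rewrite ge0_integral_sum//; last 2 first.
    by move=> r; apply/measurable_EFinP/measurable_funM.
    by move=> r x _; rewrite lee_fin mulr_ge0.
  apply: eq_bigr => r _.
  under eq_integral do rewrite EFinM.
  rewrite ge0_integralZl_EFin//; last by apply/measurable_EFinP.
  by move=> x _; rewrite lee_fin.
rewrite !aux// ge0_sume_distrr; last first.
  move=> r _; rewrite mule_ge0// integral_ge0// => x _.
  by rewrite lee_fin mulr_ge0.
by apply: eq_bigr => r _; rewrite agree// muleCA.
Qed.

(** Linearity gives simple functions, monotone convergence the rest. In a product, [V1] carries the
    remaining factors and [c] is their integral, so an indicator in one factor can be replaced by an
    arbitrary nonnegative function. *)
Lemma ge0_integral_agree (g : T -> R) :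
  measurable_fun setT g -> (forall x, 0 <= g x) ->
  (\int[mu1]_x (V1 x * g (Y1 x))%:E = c%:E * \int[mu2]_x (V2 x * g (Y2 x))%:E)%E.
Proof.
move=> mg g0.
have mEg : measurable_fun setT (EFin \o g) by apply/measurable_EFinP.
have Eg0 t : [set: T] t -> (0 <= (EFin \o g) t)%E by rewrite lee_fin.
pose f_ := nnsfun_approx measurableT mEg.
have aux d' (T' : measurableType d') (mu : {measure set T' -> \bar R}) (V : T' -> R)
    (Y : T' -> T) : measurable_fun setT V -> measurable_fun setT Y ->
    (forall x, 0 <= V x) ->
    ((\int[mu]_x (V x * f_ n (Y x))%:E)%E @[n --> \oo] -->
      (\int[mu]_x (V x * g (Y x))%:E)%E).
  move=> mV mY V0.
  rewrite (_ : (\int[mu]_x (V x * g (Y x))%:E)%E =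
     (\int[mu]_x (limn (fun n => (V x * f_ n (Y x))%:E)))%E); last first.
    apply: eq_integral => x _; apply/esym/cvg_lim => //.
    have cv := cvg_nnsfun_approx measurableT mEg Eg0 (x := Y x) I.
    rewrite (_ : (fun n => (V x * f_ n (Y x))%:E) =
       fun n => ((V x)%:E * (f_ n (Y x))%:E)%E); last by apply/funext => n; rewrite EFinM.
    rewrite EFinM; apply: cvgeZl => //; exact: cv.
  apply: cvg_monotone_convergence => //.
  - move=> n; apply/measurable_EFinP/measurable_funM => //.
    exact: measurableT_comp.
  - by move=> n x _; rewrite lee_fin mulr_ge0.
  - move=> x _ m n mn; rewrite lee_fin ler_wpM2l//.
    by apply/lefP/nd_nnsfun_approx.
have h1 := aux _ _ mu1 _ _ mV1 mY1 V10.
have h2 := aux _ _ mu2 _ _ mV2 mY2 V20.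
rewrite -(cvg_lim (@ereal_hausdorff R) h1).
under eq_fun do rewrite agree_nnsfun.
apply: (cvg_lim (@ereal_hausdorff R)).
apply: cvgeZl => //.
Qed.

End integral_agree.

Section iid_product.
Context {R : realType} {d : nat} {dO : measure_display} {Omega : measurableType dO}.
Local Notation T := (Rd R d).
Variables (nu : {measure set T -> \bar R}) (P : probability Omega R)
  (X : nat -> Omega -> T) (f : T -> R).
Hypotheses (df : is_density nu f) (iidX : iid_density nu P X f).

Let f0 x : 0 <= f x. Proof. by case: df. Qed.
Let mf : measurable_fun setT f. Proof. by case: df => _ []. Qed.
Let f1 : (\int[nu]_x (f x)%:E = 1)%E. Proof. by case: df => _ []. Qed.
Let mX k : measurable_fun setT (X k). Proof. by case: iidX. Qed.

Let integral_f_indic B : measurable B ->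
  (\int[nu]_(x in B) (f x)%:E = \int[nu]_x (f x * \1_B x)%:E)%E.
Proof.
move=> mB; rewrite integral_mkcond; apply: eq_integral => x _.
rewrite patchE indicE; case: (_ \in _); first by rewrite mulr1.
by rewrite mulr0.
Qed.

Let integral_f_indic_lty B : measurable B ->
  (\int[nu]_x (f x * \1_B x)%:E < +oo)%E.
Proof.
move=> mB; rewrite -integral_f_indic//.
apply: (@le_lt_trans _ _ (\int[nu]_x (f x)%:E)%E); last by rewrite f1 ltry.
apply: ge0_subset_integral => //; first exact/measurable_EFinP.
by move=> x _; rewrite lee_fin.
Qed.

Lemma density_integral_le1 B : measurable B ->
  (\int[nu]_(x in B) (f x)%:E <= 1)%E.
Proof.
move=> mB; rewrite -f1; apply: ge0_subset_integral => //; first exact/measurable_EFinP.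
by move=> x _; rewrite lee_fin.
Qed.

(** Induction on the number [m] of factors already turned into general functions, the others being
    still indicators; [m = 0] is the i.i.d. hypothesis. All [Bs] are quantified because the step
    varies the [m]-th set. Finiteness of the integrals keeps [fine] faithful. *)
Let prod_step n (g : nat -> T -> R) :
  (forall k, measurable_fun setT (g k)) -> (forall k x, 0 <= g k x) ->
  (forall k, (\int[nu]_x (f x * g k x)%:E < +oo)%E) ->
  forall m (Bs : nat -> set T), (m <= n)%N -> (forall k, measurable (Bs k)) ->
  let h k := if (k < m)%N then g k else \1_(Bs k) in
  (\int[P]_w (\prod_(k < n) h k (X k w))%:E =
    (\prod_(k < n) fine (\int[nu]_x (f x * h k x)%:E))%:E)%E.
Proof.
move=> mg g0 goo; elim => [|m IH] Bs mn mBs h.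
  have -> : (\int[P]_w (\prod_(k < n) h k (X k w))%:E)%E =
     P [set w | forall k, (k < n)%N -> Bs k (X k w)].
    rewrite -[in RHS](setIT [set w | forall k, (k < n)%N -> Bs k (X k w)]) -integral_indic//; last first.
      rewrite (_ : [set w | _] = \bigcap_(k in `I_n) (X k @^-1` Bs k)); last first.
        by apply/seteqP; split.
      apply: fin_bigcap_measurable => //.
      by move=> i _; rewrite -[X in measurable X]setTI; exact: mX.
    apply: eq_integral => w _; congr EFin; rewrite /h /=.
    rewrite [RHS]indicE.
    have [H|H] := pselect (forall k, (k < n)%N -> Bs k (X k w)).
      rewrite mem_set// big1// => -[k kn] _ /=; rewrite indicE.
      by rewrite mem_set//; exact: H.
    rewrite memNset//; have /existsNP[k /not_implyP[kn Hk]] := H.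
    rewrite (bigD1 (Ordinal kn))//= indicE memNset// mul0r//.
  have [_ ->//] := iidX.
  rewrite -prodEFin; apply: eq_bigr => k _.
  rewrite fineK; first by rewrite integral_f_indic.
  by rewrite /h /= ge0_fin_numE ?integral_f_indic_lty// integral_ge0// => x _; rewrite lee_fin mulr_ge0.
have h0 k x : 0 <= h k x by rewrite /h; case: ifP => // _; rewrite indicE.
have mh k : measurable_fun setT (h k).
  by rewrite /h; case: ifP => // _; exact: measurable_indic.
have int0 (u : T -> R) : (forall x, 0 <= u x) -> (0 <= \int[nu]_x (f x * u x)%:E)%E.
  by move=> u0; apply: integral_ge0 => x _; rewrite lee_fin mulr_ge0.
pose im := Ordinal mn.
rewrite (bigD1 im)//=.
under eq_integral do rewrite (bigD1 im)//= mulrC.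
have -> : h m = g m by rewrite /h ltnSn.
pose c := \prod_(i < n | i != im) fine (\int[nu]_x (f x * h i x)%:E)%E.
rewrite (@ge0_integral_agree _ _ _ _ T _ _ P nu _ f (X m) id c)//.
- rewrite EFinM muleC fineK//.
  by rewrite ge0_fin_numE// int0.
- under eq_fun do rewrite big_mkcond.
  apply: measurable_prod => i _; case: (i != im) => //.
  exact: measurableT_comp (mh _) (mX _).
- by move=> w; apply: prodr_ge0.
move=> B mB.
pose Bs' k := if k == m then B else Bs k.
have mBs' k : measurable (Bs' k) by rewrite /Bs'; case: ifP.
have /= := IH Bs' (ltnW mn) mBs'; rewrite [in RHS](bigD1 im)//= ltnn /Bs' eqxx.
have E k : k != m -> (if (k < m)%N then g k else \1_(if k == m then B else Bs k)) = h k.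
  by move=> km; rewrite /h [in RHS]ltnS [in RHS]leq_eqVlt (negbTE km).
have -> : \prod_(i < n | i != im) fine (\int[nu]_x
   (f x * (if (i < m)%N then g i else \1_(if i == m :> nat then B else Bs i)) x)%:E)%E = c.
  by apply: eq_bigr => i im'; rewrite E.
move=> H.
transitivity (\int[P]_w (\prod_(k < n) (if (k < m)%N then g k
   else \1_(if k == m :> nat then B else Bs k)) (X k w))%:E)%E.
  apply: eq_integral => w _; rewrite [in RHS](bigD1 im)//= ltnn eqxx mulrC.
  by congr (_ * _)%:E; apply: eq_bigr => i im'; rewrite E.
rewrite H EFinM muleC fineK// ge0_fin_numE ?integral_f_indic_lty//.
by apply: int0 => x; rewrite indicE.
Qed.

Lemma iid_integral_prod n (g : nat -> T -> R) :
  (forall k, measurable_fun setT (g k)) -> (forall k x, 0 <= g k x) ->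
  (forall k, (\int[nu]_x (f x * g k x)%:E < +oo)%E) ->
  (\int[P]_w (\prod_(k < n) g k (X k w))%:E =
    (\prod_(k < n) fine (\int[nu]_x (f x * g k x)%:E))%:E)%E.
Proof.
move=> mg g0 goo.
have := prod_step n _ mg g0 goo n (fun=> setT) (leqnn n) (fun=> measurableT).
rewrite /= => H.
transitivity (\int[P]_w (\prod_(k < n) (if (k < n)%N then g k else \1_setT) (X k w))%:E)%E.
  by apply: eq_integral => w _; congr EFin; apply: eq_bigr => k _; rewrite ltn_ord.
rewrite H; congr EFin; apply: eq_bigr => k _.
by congr fine; apply: eq_integral => x _; rewrite ltn_ord.
Qed.

Lemma iid_marginal k B : measurable B ->
  P [set w | B (X k w)] = (\int[nu]_(x in B) (f x)%:E)%E.
Proof.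
move=> mB; have [_ H] := iidX.
have := H k.+1 (fun i => if i == k then B else setT).
rewrite big_ord_recr/= eqxx big1 ?mul1e; last first.
  by move=> i _; rewrite ltn_eqF.
move=> <-; last by move=> i; case: ifP.
congr (P _); apply/seteqP; split => w /=.
  by move=> Bw i; case: eqP => [->|].
by move=> /(_ k (ltnSn _)); rewrite eqxx.
Qed.

Lemma iid_integral k (g : T -> R) : measurable_fun setT g -> (forall x, 0 <= g x) ->
  (\int[P]_w (g (X k w))%:E = \int[nu]_x (f x * g x)%:E)%E.
Proof.
move=> mg g0.
transitivity (\int[P]_w (1 * g (X k w))%:E)%E.
  by apply: eq_integral => w _; rewrite mul1r.
rewrite (@ge0_integral_agree _ _ _ _ T _ _ P nu (fun=> 1) f (X k) id 1) ?mul1e//.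
move=> B mB; rewrite mul1e -integral_f_indic// -(iid_marginal k _ mB).
under eq_integral do rewrite mul1r.
have mXB : measurable (X k @^-1` B) by rewrite -[X in measurable X]setTI; exact: mX.
by have := integral_indic P measurableT mXB; rewrite setIT => <-.
Qed.

End iid_product.

Lemma measurable_neq {R : realType} {d} {T : measurableType d} (g h : T -> R) :
  measurable_fun setT g -> measurable_fun setT h -> measurable [set x | g x != h x].
Proof.
move=> mg mh.
rewrite (_ : [set x | _] = ~` ([set x | g x <= h x] `&` [set x | h x <= g x])).
  apply/measurableC/measurableI.
    by have := measurable_fun_le measurableT mg mh; rewrite setTI.
  by have := measurable_fun_le measurableT mh mg; rewrite setTI.
apply/seteqP; split => x /=; rewrite eq_le.
  by move=> /negP H [gh hg]; apply: H; rewrite gh.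
by move=> H; apply/negP => /andP[gh hg]; exact: H.
Qed.

Lemma prob_markov {R : realType} {d} {T : measurableType d} (P : probability T R)
    (Y : T -> R) (a C : R) : measurable_fun setT Y -> (forall w, 0 <= Y w) -> 0 < a ->
  (\int[P]_w (Y w)%:E <= C%:E)%E -> fine (P [set w | a <= Y w]) <= C / a.
Proof.
move=> mY Y0 a0 YC.
have mB : measurable [set w | a <= Y w].
  by rewrite -[X in measurable X]setTI; exact: measurable_fun_le.
rewrite ler_pdivlMr// mulrC -lee_fin EFinM fineK ?fin_num_measure//.
apply: le_trans YC.
have := integral_indic P measurableT mB; rewrite setIT => <-.
have mE : measurable_fun setT (fun w => ((\1_[set w | a <= Y w] w : R))%:E).
  by apply/measurable_EFinP; exact: measurable_indic.
have E0 w : [set: T] w -> (0 <= (\1_[set w | a <= Y w] w : R)%:E)%E.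
  by rewrite lee_fin indicE.
rewrite -(ge0_integralZl_EFin P measurableT E0 mE (ltW a0)).
apply: ge0_le_integral => //.
- by move=> w _; rewrite mule_ge0 ?E0// lee_fin ltW.
- exact: measurable_funeM.
- exact/measurable_EFinP.
move=> w _; rewrite -EFinM lee_fin indicE.
have [aY|naY] := pselect (a <= Y w); first by rewrite mem_set// mulr1.
by rewrite memNset// mulr0.
Qed.

(** [expR (- y) >= 1 - y] gives [expR y <= 1 / (1 - y)], and [(1 + y + 2 y^2) (1 - y) = 1 + y^2 (1 -
    2 y) >= 1]. *)
Lemma expR_le_quadratic {R : realType} (y : R) : y <= 2^-1 ->
  expR y <= 1 + y + 2 * y ^+ 2.
Proof.
move=> y2; have y1 : 0 < 1 - y by lra.
have h : expR y <= (1 - y)^-1.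
  rewrite -[leLHS]invrK -expRN lef_pV2 ?posrE ?expR_gt0//.
  exact: expR_ge1Dx.
apply: le_trans h _; rewrite -[leLHS]mul1r ler_pdivrMr//.
have -> : (1 + y + 2 * y ^+ 2) * (1 - y) = 1 + y ^+ 2 * (1 - 2 * y) by ring.
by rewrite lerDl mulr_ge0 ?sqr_ge0//; lra.
Qed.

(** * Step approximations of the exponential *)

Section exponential_step.
Context {R : realType}.
Implicit Types eta x : R.

(* The increments of the lattice values of [x |-> expR (- x)]: summing them
   over the lattice points above [x] approximates [expR (- x)]. *)
Definition step_weight eta (k : nat) : R :=
  expR (- (k%:R * eta)) - expR (- (k.+1%:R * eta)).

Definition exp_step eta (N : nat) x : R :=
  \sum_(k < N) step_weight eta k * (x <= k.+1%:R * eta)%R%:R.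

Lemma step_weight_ge0 eta k : 0 <= eta -> 0 <= step_weight eta k.
Proof.
by move=> eta0; rewrite subr_ge0 ler_expR lerN2 ler_wpM2r// ler_nat.
Qed.

Lemma sum_step_weight eta N : 0 <= eta -> \sum_(k < N) step_weight eta k <= 1.
Proof.
move=> eta0; rewrite -(big_mkord xpredT (step_weight eta)).
rewrite (telescope_sumr_eq (fun k => - expR (- (k%:R * eta))))//.
  by rewrite mul0r oppr0 expR0 opprK addrC lerBlDr lerDl expR_ge0.
by move=> k _; rewrite /step_weight opprK addrC.
Qed.

Lemma exp_step_ge0 eta N x : 0 <= eta -> 0 <= exp_step eta N x.
Proof. by move=> eta0; apply: sumr_ge0 => k _; rewrite mulr_ge0// step_weight_ge0. Qed.

(** The weights kept belong to lattice points at or above [x] and telescope to at most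
    [expR (eta - x) - expR (- (N * eta))]; the factor [expR (- eta)] pays for one lattice step. This
    sharper bound is what the induction carries. *)
Lemma exp_step_le eta N x : 0 <= eta -> expR (- eta) * exp_step eta N x <= expR (- x).
Proof.
move=> eta0.
suff [H1 H2] : (x <= N%:R * eta -> exp_step eta N x <= expR (eta - x) - expR (- (N%:R * eta))) /\
    (N%:R * eta < x -> exp_step eta N x = 0).
  have [/H1 h|/H2 ->] := leP x (N%:R * eta); last by rewrite mulr0 expR_ge0.
  rewrite -ler_pdivlMl ?expR_gt0// -expRN opprK -expRD; apply: le_trans h _.
  by rewrite gerBl expR_ge0.
elim: N => [|N [IH1 IH2]].
  rewrite /exp_step big_ord0 mul0r oppr0 expR0; split => // x0.
  by rewrite subr_ge0 -expR0 ler_expR; lra.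
have E : exp_step eta N.+1 x = exp_step eta N x + step_weight eta N * (x <= N.+1%:R * eta)%R%:R.
  by rewrite /exp_step big_ord_recr.
have N1 : N%:R * eta <= N.+1%:R * eta by rewrite ler_wpM2r// ler_nat.
split=> xN; rewrite E; last first.
  by rewrite IH2 ?(le_lt_trans N1)// leNgt xN mulr0 add0r.
rewrite xN mulr1; have [h|h] := leP x (N%:R * eta).
  by have := IH1 h; rewrite /step_weight; lra.
rewrite IH2// add0r /step_weight lerD2r ler_expR.
by move: xN; rewrite -natr1 mulrDl; lra.
Qed.

Lemma exp_step_ge eta N x : 0 <= eta -> 0 <= x ->
  expR (- x) <= exp_step eta N x + expR (- (N%:R * eta)).
Proof.
move=> eta0 x0; elim: N => [|N IH].
  by rewrite /exp_step big_ord0 mul0r oppr0 expR0 add0r -expR0 ler_expR; lra.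
have E : exp_step eta N.+1 x = exp_step eta N x + step_weight eta N * (x <= N.+1%:R * eta)%R%:R.
  by rewrite /exp_step big_ord_recr.
rewrite E; have [h|h] := leP x (N.+1%:R * eta).
  by move: IH; rewrite /step_weight mulr1; lra.
have := exp_step_ge0 _ N x eta0.
have : expR (- x) <= expR (- (N.+1%:R * eta)) by rewrite ler_expR; lra.
by rewrite mulr0; lra.
Qed.

Lemma expR_lattice_small eta (e : R) : 0 < eta -> 0 < e ->
  exists N : nat, expR (- (N%:R * eta)) <= e.
Proof.
move=> eta0 e0; exists (Num.truncn (e^-1 / eta)).+1.
rewrite expRN.
rewrite -[leRHS]invrK lef_pV2 ?posrE ?expR_gt0 ?invr_gt0//.
apply: le_trans (expR_ge1Dx _).
have : e^-1 / eta < (Num.truncn (e^-1 / eta)).+1%:R by exact: truncnS_gt.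
by rewrite ltr_pdivrMr//; lra.
Qed.

Variable mu : probability R R.
Hypothesis mu0 : mu `[0, +oo[%classic = 1%E.

Let Dp : set R := `[0, +oo[%classic.
Let mDp : measurable Dp. Proof. exact: measurable_itv. Qed.

Definition cdf_le x : R := fine (mu `]-oo, x]%classic).

Let mu_nneg x : mu (`]-oo, x]%classic `&` Dp) = (cdf_le x)%:E.
Proof.
have mx : measurable (`]-oo, x]%classic : set R) by exact: measurable_itv.
rewrite /cdf_le fineK ?fin_num_measure//.
have muC : mu (~` Dp) = 0%E by rewrite probability_setC// mu0 subee.
apply/eqP; rewrite eq_le; apply/andP; split.
  by apply: le_measure; rewrite ?inE//; exact: measurableI.
apply: (@le_trans _ _ (mu (`]-oo, x]%classic `&` Dp) + mu (~` Dp))%E); last by rewrite muC adde0.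
apply: le_trans (measureU2 _ _ _); last 2 first.
  - exact: measurableI.
  - exact: measurableC.
apply: le_measure; rewrite ?inE//.
  by apply: measurableU; [exact: measurableI|exact: measurableC].
by move=> y yx; have [|] := pselect (Dp y); [left|right].
Qed.

Let measurable_expN : measurable_fun Dp (fun x : R => (expR (- x))%:E).
Proof.
apply/measurable_EFinP; apply: measurable_funTS.
exact: measurableT_comp (@measurable_expR R) _.
Qed.

Lemma overshoot_constE :
  (\int[mu]_(x in Dp) (expR (- x))%:E = (overshoot_const mu)%:E)%E.
Proof.
rewrite /overshoot_const fineK// ge0_fin_numE; last first.
  by apply: integral_ge0 => x _; rewrite lee_fin expR_ge0.
apply: (@le_lt_trans _ _ (\int[mu]_(x in Dp) (cst 1%E x))%E); last first.
  by rewrite integral_cst// mul1e (le_lt_trans (probability_le1 mu mDp)) ?ltry.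
apply: ge0_le_integral => //.
move=> x; rewrite /Dp /= in_itv/= andbT => x0.
by rewrite lee_fin -expR0 ler_expR oppr_le0.
Qed.

Let integral_exp_step eta N : 0 <= eta ->
  (\int[mu]_(x in Dp) (exp_step eta N x)%:E =
   (\sum_(k < N) step_weight eta k * cdf_le (k.+1%:R * eta))%:E)%E.
Proof.
move=> eta0.
have mI k : measurable (`]-oo, (k.+1%:R * eta)]%classic : set R) by exact: measurable_itv.
have mind k : measurable_fun Dp (fun x => ((\1_(`]-oo, (k.+1%:R * eta)]%classic : set R) x : R))%:E).
  by apply/measurable_EFinP; apply: measurable_funTS; exact: measurable_indic.
rewrite -sumEFin.
transitivity (\int[mu]_(x in Dp) (\sum_(k < N)
    ((step_weight eta k)%:E * (\1_(`]-oo, (k.+1%:R * eta)]%classic : set R) x)%:E)))%E.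
  apply: eq_integral => x _; rewrite -sumEFin; apply: eq_bigr => k _.
  by rewrite -EFinM indicE mem_setE in_itv.
rewrite ge0_integral_sum//; last 2 first.
- move=> k; exact: measurable_funeM.
- by move=> k x _; rewrite -EFinM lee_fin mulr_ge0 ?step_weight_ge0// indicE.
apply: eq_bigr => k _; rewrite ge0_integralZl_EFin ?step_weight_ge0//.
by rewrite EFinM; congr (_ * _)%E; apply: etrans (integral_indic mu mDp (mI k)) _; exact: mu_nneg.
Qed.

Let measurable_exp_step eta N : measurable_fun Dp (fun x => (exp_step eta N x)%:E).
Proof.
apply/measurable_EFinP/measurable_funTS; apply: measurable_sum => k.
apply: measurable_funM; first exact: measurable_cst.
rewrite (_ : (fun x : R => _) = \1_(`]-oo, (k.+1%:R * eta)]%classic : set R)).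
  by apply: measurable_indic; exact: measurable_itv.
by apply/funext => x; rewrite indicE mem_setE in_itv.
Qed.

(** Integrating the two step approximations leaves finitely many values of the distribution
    function, all at positive points, which is where convergence of the overshoot law is assumed. *)
Lemma overshoot_const_bounds eta N : 0 <= eta ->
  expR (- eta) * (\sum_(k < N) step_weight eta k * cdf_le (k.+1%:R * eta))
    <= overshoot_const mu <=
  \sum_(k < N) step_weight eta k * cdf_le (k.+1%:R * eta) + expR (- (N%:R * eta)).
Proof.
move=> eta0; apply/andP; split.
- rewrite -lee_fin -overshoot_constE EFinM -integral_exp_step//.
  rewrite -ge0_integralZl_EFin ?expR_ge0//; last first.
    by move=> x _; rewrite lee_fin exp_step_ge0.
  apply: ge0_le_integral => //.
  + by move=> x _; rewrite -EFinM lee_fin mulr_ge0 ?exp_step_ge0 ?expR_ge0.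
  + exact: measurable_funeM.
  + by move=> x _; rewrite -EFinM lee_fin exp_step_le.
- rewrite -lee_fin -overshoot_constE EFinD -integral_exp_step//.
  have -> : (expR (- (N%:R * eta)))%:E =
      (\int[mu]_(x in Dp) (cst (expR (- (N%:R * eta)))%:E x))%E.
    by rewrite integral_cst// -[LHS]mule1; congr (_ * _)%E; exact/esym/mu0.
  rewrite -ge0_integralD//; last 2 first.
  + by move=> x _; rewrite lee_fin exp_step_ge0.
  + by move=> x _; rewrite lee_fin expR_ge0.
  apply: ge0_le_integral => //.
  + exact: emeasurable_funD.
  + move=> x; rewrite /Dp /= in_itv/= andbT => x0.
    by rewrite -EFinD lee_fin exp_step_ge.
Qed.

(** If the constant were 0, the lower bound with a single step of mesh [n.+1] would give mass 0 to
    each half-line up to [n.+1], hence to the whole line. Positivity is what allows errors to be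
    measured relative to the limit. *)
Lemma overshoot_const_gt0 : 0 < overshoot_const mu.
Proof.
rewrite lt_neqAle; apply/andP; split; last first.
  rewrite -lee_fin -overshoot_constE.
  by apply: integral_ge0 => x _; rewrite lee_fin expR_ge0.
apply/negP => /eqP g0.
have cdf0 n : cdf_le (1%:R * n.+1%:R) = 0.
  have n0 : 0 <= n.+1%:R :> R by [].
  have /andP[+ _] := overshoot_const_bounds _ 1 n0.
  rewrite -g0 big_ord1/= pmulr_rle0 ?expR_gt0// pmulr_rle0; last first.
    by rewrite subr_gt0 ltr_expR ltrN2 mul0r mul1r ltr0n.
  by move=> h; apply/eqP; rewrite eq_le h fine_ge0.
have : mu setT = 0%E.
  apply: measure_negligible => //.
  apply: (@negligibleS _ _ _ _ (\bigcup_n `]-oo, (1%:R * n.+1%:R : R)]%classic)).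
    move=> x _; exists (Num.truncn x) => //=; rewrite in_itv/= mul1r ltW//.
    exact: truncnS_gt.
  apply: negligible_bigcup => n; apply/negligibleP; first exact: measurable_itv.
  by rewrite -[LHS]fineK ?fin_num_measure//; congr EFin; exact: cdf0.
by rewrite probability_setT => /eqP; rewrite onee_eq0.
Qed.

End exponential_step.

(** * Change of measure on the past *)

Section change_of_measure.
Context {R : realType} {d : nat} {dO : measure_display} {Omega : measurableType dO}.
Local Notation T := (Rd R d).
Variables (nu : {measure set T -> \bar R}) (K : nat) (f : nat -> T -> R)
  (P : nat -> probability Omega R) (X : nat -> Omega -> T).
Hypotheses (dens : forall j, (j <= K)%N -> is_density nu (f j))
  (supp : forall j x, (j <= K)%N -> (0 < f j x) = (0 < f 0%N x))
  (iidX : forall j, (j <= K)%N -> iid_density nu (P j) X (f j)).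

(** The events whose probability the i.i.d. hypothesis gives; being closed under intersection, they
    can start a Dynkin argument. *)
Definition rect (t : nat) : set (set Omega) :=
  [set A | exists2 Bs : nat -> set T, (forall k, measurable (Bs k)) &
     A = [set w | forall k, (k < t)%N -> Bs k (X k w)]].

Definition past (t : nat) : set (set Omega) := <<s rect t >>.

Let mX k : measurable_fun setT (X k). Proof. by case: (iidX 0%N (leq0n K)). Qed.
Let mf i : (i <= K)%N -> measurable_fun setT (f i).
Proof. by move=> iK; case: (dens i iK) => _ []. Qed.
Let f0 i x : (i <= K)%N -> 0 <= f i x. Proof. by move=> iK; case: (dens i iK). Qed.

Lemma rect_setI t : setI_closed (rect t).
Proof.
move=> _ _ [B mB ->] [C mC ->]; exists (fun k => B k `&` C k).
  by move=> k; exact: measurableI.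
apply/seteqP; split => w /=.
  by move=> [H1 H2] k kt; split; [exact: H1|exact: H2].
by move=> H; split=> k kt; case: (H k kt).
Qed.

Lemma rect_measurable t : rect t `<=` measurable.
Proof.
move=> _ [B mB ->].
rewrite (_ : [set w | _] = \bigcap_(k in `I_t) (X k @^-1` B k)); last first.
  by apply/seteqP; split.
apply: fin_bigcap_measurable => // i _.
by rewrite -[X in measurable X]setTI; exact: mX.
Qed.

Lemma past_measurable t A : past t A -> measurable A.
Proof.
move=> pA; apply: (smallest_sub (sigma_algebra_measurable Omega)) pA.
exact: rect_measurable.
Qed.

Lemma past_sigma_algebra t : sigma_algebra setT (past t).
Proof. exact: smallest_sigma_algebra. Qed.

Lemma pastC t A : past t A -> past t (~` A).
Proof. by case: (past_sigma_algebra t) => _ + _ => /[apply]; rewrite setTD. Qed.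

Lemma past_bigcup t (A : nat -> set Omega) :
  (forall n, past t (A n)) -> past t (\bigcup_n A n).
Proof. by case: (past_sigma_algebra t) => _ _; exact. Qed.

Lemma past0 t : past t set0.
Proof. by case: (past_sigma_algebra t). Qed.

Lemma pastT t : past t setT.
Proof. by rewrite -setC0; apply: pastC; exact: past0. Qed.

Lemma pastU t A B : past t A -> past t B -> past t (A `|` B).
Proof.
move=> pA pB; rewrite -bigcup2E; apply: past_bigcup => -[|[|n]] //=.
exact: past0.
Qed.

Lemma pastI t A B : past t A -> past t B -> past t (A `&` B).
Proof.
move=> pA pB; rewrite -(setCK (A `&` B)) setCI; apply: pastC.
by apply: pastU; exact: pastC.
Qed.

Lemma pastD t A B : past t A -> past t B -> past t (A `\` B).
Proof. by move=> pA pB; rewrite setDE; apply: pastI => //; exact: pastC. Qed.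

Lemma past_prop t (Q : Prop) : past t [set _ | Q].
Proof.
have [q|nq] := pselect Q.
  rewrite (_ : [set _ | _] = setT); last by apply/seteqP; split.
  exact: pastT.
rewrite (_ : [set _ | _] = set0); last by apply/seteqP; split.
exact: past0.
Qed.

Lemma past_mono s t A : (s <= t)%N -> past s A -> past t A.
Proof.
move=> st; apply: smallest_sub; first exact: past_sigma_algebra.
move=> _ [B mB ->]; apply: sub_gen_smallest.
exists (fun k => if (k < s)%N then B k else setT); first by move=> k; case: ifP.
apply/seteqP; split => w /=.
  by move=> H k _; case: ifP => // /H.
by move=> H k ks; have := H k (leq_trans ks st); rewrite ks.
Qed.

Definition past_fun (t : nat) (U : Omega -> R) : Prop :=
  @measurable_fun _ _ (g_sigma_algebraType (rect t)) R setT U.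

Lemma past_fun_le t U V : past_fun t U -> past_fun t V -> past t [set w | U w <= V w].
Proof.
move=> mU mV.
have := @measurable_fun_le _ (g_sigma_algebraType (rect t)) R _ _ _ measurableT mU mV.
by rewrite setTI.
Qed.

Lemma past_fun_lt t U V : past_fun t U -> past_fun t V -> past t [set w | U w < V w].
Proof.
move=> mU mV; rewrite (_ : [set w | _] = ~` [set w | V w <= U w]).
  by apply: pastC; exact: past_fun_le.
by apply/seteqP; split => w /=; rewrite ltNge => /negP.
Qed.

Lemma past_fun_cst t c : past_fun t (fun=> c).
Proof. exact: (@measurable_cst _ _ (g_sigma_algebraType (rect t))). Qed.

Lemma past_funM t U V : past_fun t U -> past_fun t V ->
  past_fun t (fun w => U w * V w).
Proof. by move=> mU mV; apply: (@measurable_funM _ (g_sigma_algebraType (rect t))). Qed.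

Lemma past_fun_comp t (g : R -> R) U : measurable_fun setT g -> past_fun t U ->
  past_fun t (g \o U).
Proof.
by move=> mg mU; apply: (@measurableT_comp _ _ _ (g_sigma_algebraType (rect t))).
Qed.

Lemma past_fun_sum t (s : seq nat) (U : nat -> Omega -> R) :
  (forall i, i \in s -> past_fun t (U i)) ->
  past_fun t (fun w => \sum_(i <- s) U i w).
Proof.
elim: s => [|a s IH] H; first by under eq_fun do rewrite big_nil; exact: past_fun_cst.
under eq_fun do rewrite big_cons.
apply: (@measurable_funD _ (g_sigma_algebraType (rect t))).
  by apply: H; rewrite mem_head.
by apply: IH => i si; apply: H; rewrite in_cons si orbT.
Qed.

Lemma past_fun_bigmax t (s : seq nat) (U : nat -> Omega -> R) :
  (forall i, i \in s -> past_fun t (U i)) ->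
  past_fun t (fun w => \big[Num.max/0]_(i <- s) U i w).
Proof.
elim: s => [|a s IH] H; first by under eq_fun do rewrite big_nil; exact: past_fun_cst.
under eq_fun do rewrite big_cons.
apply: (@measurable_maxr _ (g_sigma_algebraType (rect t))).
  by apply: H; rewrite mem_head.
by apply: IH => i si; apply: H; rewrite in_cons si orbT.
Qed.

Lemma past_fun_X t k (g : T -> R) : (k < t)%N -> measurable_fun setT g ->
  past_fun t (g \o X k).
Proof.
move=> kt mg.
apply: (@measurableT_comp _ _ _ (g_sigma_algebraType (rect t)) _ _ _ _ _ mg).
move=> _ B mB; rewrite setTI; apply: sub_gen_smallest.
exists (fun i => if i == k then B else setT); first by move=> i; case: ifP.
apply/seteqP; split => w /=.
  by move=> H i it; case: eqP => // ->.
by move=> /(_ k kt); rewrite eqxx.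
Qed.

Lemma measurable_lr i : (i <= K)%N -> measurable_fun setT (fun x => f i x / f 0%N x).
Proof.
move=> iK; apply: measurable_funM; first exact: mf.
apply: measurable_fun_inv_ge0; last exact: mf.
by move=> x; apply: f0.
Qed.

Lemma LR_past i s t : (i <= K)%N -> (s <= t)%N -> past_fun t (LR f X i s).
Proof.
move=> iK st; apply: (@measurable_prod _ (g_sigma_algebraType (rect t))) => k _.
apply: (past_fun_X t k (fun x => f i x / f 0%N x)).
  exact: leq_trans (ltn_ord k) st.
exact: measurable_lr.
Qed.

Lemma past_fun_measurable t U : past_fun t U -> measurable_fun setT U.
Proof.
move=> mU _ B mB; rewrite setTI.
have := mU measurableT B mB; rewrite setTI; exact: past_measurable.
Qed.

Lemma LR_ge0 i t w : (i <= K)%N -> 0 <= LR f X i t w.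
Proof. by move=> iK; apply: prodr_ge0 => k _; rewrite divr_ge0 ?f0. Qed.

(** Common support: where [f 0] vanishes so does [f i], and the conventional value of division by 0
    does no harm. *)
Lemma f0_lr i x : (i <= K)%N -> f 0%N x * (f i x / f 0%N x) = f i x.
Proof.
move=> iK; have := f0 0%N x (leq0n _); rewrite le_eqVlt => /predU1P[f00|f00].
  have := supp i x iK; rewrite -f00 mul0r ltxx => /negbT; rewrite -leNgt => h.
  by apply/eqP; rewrite eq_le h f0.
by rewrite mulrCA divff ?mulr1// gt_eqF.
Qed.

Let change_rect i t A : (i <= K)%N -> rect t A ->
  (P i A = \int[P 0%N]_(w in A) (LR f X i t w)%:E)%E.
Proof.
move=> iK [B mB ->]; have [_ ->//] := iidX i iK.
rewrite integral_mkcond.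
pose g k x := (f i x / f 0%N x) * \1_(B k) x.
have Eg k : (\int[nu]_x (f 0%N x * g k x)%:E = \int[nu]_(x in B k) (f i x)%:E)%E.
  rewrite [RHS]integral_mkcond; apply: eq_integral => x _.
  rewrite patchE /g mulrA f0_lr// indicE; case: (_ \in _); first by rewrite mulr1.
  by rewrite mulr0.
have fin k : (\int[nu]_x (f 0%N x * g k x)%:E)%E \is a fin_num.
  rewrite Eg ge0_fin_numE; last first.
    by apply: integral_ge0 => x _; rewrite lee_fin f0.
  exact: le_lt_trans (density_integral_le1 _ _ (dens i iK) _ (mB k)) (ltry _).
transitivity (\int[P 0%N]_w (\prod_(k < t) g k (X k w))%:E)%E; last first.
  apply: eq_integral => w _; rewrite patchE; case: ifPn => wB.
    congr EFin; apply: eq_bigr => k _; rewrite /g indicE mem_set ?mulr1//.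
    by move: wB; rewrite inE => /(_ k (ltn_ord k)).
  move: wB; rewrite notin_setE /= => /existsNP[k /not_implyP[kt nB]].
  by rewrite (bigD1 (Ordinal kt))//= /g indicE memNset// mulr0 mul0r.
rewrite (iid_integral_prod _ _ _ _ (dens 0%N (leq0n _)) (iidX 0%N (leq0n _))).
- by rewrite -prodEFin; apply: eq_bigr => k _; rewrite fineK// Eg.
- move=> k; apply: measurable_funM; first exact: measurable_lr.
  exact: measurable_indic.
- by move=> k x; rewrite /g mulr_ge0// ?divr_ge0 ?f0// indicE.
- by move=> k; move: (fin k); rewrite fin_numElt => /andP[].
Qed.

(** Both sides are additive in [A] and agree on rectangles, so the events where they agree form a
    lambda-system containing [past t]. The rectangle [setT] supplies the equality of total masses
    needed for complements. *)
Lemma change_of_measure i t A : (i <= K)%N -> past t A ->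
  (P i A = \int[P 0%N]_(w in A) (LR f X i t w)%:E)%E.
Proof.
move=> iK pA.
have mL : measurable_fun setT (EFin \o LR f X i t).
  by apply/measurable_EFinP; exact: past_fun_measurable (LR_past _ _ t iK (leqnn _)).
have L0 (w : Omega) : (0 <= (LR f X i t w)%:E)%E by rewrite lee_fin LR_ge0.
suff : past t `<=` [set A | measurable A /\
    (P i A = \int[P 0%N]_(w in A) (LR f X i t w)%:E)%E] by move=> /(_ _ pA)[].
have rT : rect t setT.
  by exists (fun=> setT) => //; apply/seteqP; split.
apply: lambda_system_subset => //.
- exact: rect_setI.
- apply/dynkin_lambda_system; split.
  + by split => //; exact: change_rect.
  + move=> B [mB EB]; split; first exact: measurableC.
    have ET := change_rect _ _ _ iK rT.
    have := @ge0_integral_setU _ _ _ (P 0%N) B (~` B) mB (measurableC mB)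
      (fun w => (LR f X i t w)%:E).
    rewrite setUCr -ET -EB => H.
    have {}H : (P i setT = P i B + \int[P 0%N]_(w in ~` B) (LR f X i t w)%:E)%E.
      apply: H => //.
      by rewrite disj_set2E setICr.
    have finB : P i B \is a fin_num by exact: fin_num_measure.
    by rewrite probability_setC// -(@probability_setT _ _ _ (P i)) H addeAC subee// add0e.
  + move=> F tF HF; split; first by apply: bigcup_measurable => k _; case: (HF k).
    have mF k : measurable (F k) by case: (HF k).
    rewrite (measure_semi_bigcup (P i) mF tF (bigcupT_measurable _ mF)).
    rewrite ge0_integral_bigcup//; first by apply: eq_eseriesr => k _; case: (HF k).
    exact: measurable_funTS.
- by move=> B rB; split; [exact: rect_measurable rB|exact: change_rect].
Qed.

(** Encodes a stopping time together with an event known at that time; disjointness makes the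
    probabilities add up. *)
Definition adapted (G : nat -> set Omega) : Prop :=
  (forall t, past t (G t)) /\ trivIset setT G.

Lemma adapted_measurable G : adapted G -> measurable (\bigcup_t G t).
Proof.
by move=> [pG _]; apply: bigcupT_measurable => t; exact: past_measurable (pG t).
Qed.

Lemma adaptedI G E : adapted G -> (forall t, past t (E t)) ->
  adapted (fun t => G t `&` E t).
Proof.
move=> [pG tG] pE; split; first by move=> t; exact: pastI.
by apply: trivIset_setIr.
Qed.

(** [seqDU C t] is the event that [t] is the first time at which [C] holds. *)
Lemma adapted_first C : (forall t, past t (C t)) -> adapted (seqDU C).
Proof.
move=> pC; split; last exact: trivIset_seqDU.
move=> t; rewrite /seqDU; apply: pastD => //.
rewrite -bigcup_mkord bigcup_mkcond; apply: past_bigcup => k.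
case: ifP => [/set_mem|_]; last exact: past0.
by move=> /= kt; exact: past_mono (ltnW kt) (pC k).
Qed.

(** Makes the comparison at a fixed time a special case of the comparison along a family. *)
Lemma adapted_at t A : past t A -> adapted (fun s => if s == t :> nat then A else set0).
Proof.
move=> pA; split; first by move=> s; case: eqP => [->//|_]; exact: past0.
apply/trivIsetP => i j _ _ ij; case: eqP => [it|_]; last by rewrite set0I.
by case: eqP => [jt|_]; [move: ij; rewrite it jt eqxx|rewrite setI0].
Qed.

Lemma bigcup_at t (A : set Omega) : \bigcup_s (if s == t :> nat then A else set0) = A.
Proof.
apply/seteqP; split => w; first by move=> [s _]; case: eqP.
by move=> Aw; exists t => //; rewrite eqxx.
Qed.

Definition prob i (A : set Omega) : R := fine (P i A).

Lemma probE i A : measurable A -> P i A = (prob i A)%:E.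
Proof. by move=> mA; rewrite fineK// fin_num_measure. Qed.

Lemma prob_ge0 i A : 0 <= prob i A.
Proof. exact: fine_ge0. Qed.

Lemma prob_le i A B : measurable A -> measurable B -> A `<=` B -> prob i A <= prob i B.
Proof.
by move=> mA mB AB; rewrite -lee_fin -!probE// le_measure// inE.
Qed.

Lemma prob_le1 i A : measurable A -> prob i A <= 1.
Proof. by move=> mA; rewrite -lee_fin -probE// probability_le1. Qed.

Lemma prob_leU i A B : measurable A -> measurable B ->
  prob i (A `|` B) <= prob i A + prob i B.
Proof.
move=> mA mB; rewrite -lee_fin EFinD -!probE//; last exact: measurableU.
exact: measureU2.
Qed.

(** * Null events and linear comparison of probabilities under different hypotheses *)

Variable D : set T.
Hypotheses (mD : measurable D) (D0 : forall x, D x -> 0 < f 0%N x)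
  (Dnull : forall j, (j <= K)%N -> (\int[nu]_(x in ~` D) (f j x)%:E = 0)%E).

(** On this event every ratio is positive and [LR] of index 0 equals 1. It has full probability
    under each hypothesis; [ok_upto t] is the part of it that belongs to [past t]. *)
Definition ok : set Omega := [set w | forall k, D (X k w)].
Definition ok_upto (t : nat) : set Omega := [set w | forall k, (k < t)%N -> D (X k w)].

Let ok_upto_past t : past t (ok_upto t).
Proof. by apply: sub_gen_smallest; exists (fun=> D). Qed.

Lemma ok_measurable : measurable ok.
Proof.
rewrite (_ : ok = \bigcap_k (X k @^-1` D)); last first.
  by apply/seteqP; split => w; [move=> H k _; exact: H|move=> H k; exact: H].
by apply: bigcapT_measurable => k; rewrite -[X in measurable X]setTI; exact: mX.
Qed.

Lemma notok_null j : (j <= K)%N -> P j (~` ok) = 0%E.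
Proof.
move=> jK.
have -> : ~` ok = \bigcup_k [set w | (~` D) (X k w)].
  apply/seteqP; split => w /=; first by move=> /existsNP[k Dk]; exists k.
  by move=> [k _ Dk] H; exact/Dk/H.
have mk k : measurable [set w | (~` D) (X k w)].
  by rewrite -[X in measurable X]setTI; apply: mX => //; exact: measurableC.
apply: measure_negligible; first exact: bigcupT_measurable.
apply: negligible_bigcup => k; apply/negligibleP => //.
exact: etrans (iid_marginal _ _ _ _ (dens j jK) (iidX j jK) k _ (measurableC mD)) (Dnull j jK).
Qed.

Lemma prob_mono_ok j A B : (j <= K)%N -> measurable A -> measurable B ->
  A `&` ok `<=` B -> prob j A <= prob j B.
Proof.
move=> jK mA mB AB; have mok := ok_measurable.
apply: (@le_trans _ _ (prob j (A `&` ok) + prob j (~` ok))).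
  apply: le_trans (prob_leU _ _ _ _ _); try exact: measurableC; try exact: measurableI.
  apply: prob_le => //; first by apply: measurableU; [exact: measurableI|exact: measurableC].
  by move=> w Aw; have [|] := pselect (ok w); [left|right].
rewrite [X in _ + X]/prob notok_null// addr0; apply: prob_le => //; exact: measurableI.
Qed.

Let prob_ok_upto j t A : (j <= K)%N -> past t A -> prob j (A `&` ok_upto t) = prob j A.
Proof.
move=> jK pA; have pI := pastI _ _ _ pA (ok_upto_past t).
apply/eqP; rewrite eq_le; apply/andP; split.
  by apply: prob_le; [exact: past_measurable pI|exact: past_measurable pA|].
apply: prob_mono_ok => //; [exact: past_measurable pA|exact: past_measurable pI|].
by move=> w [Aw okw]; split => // k _; exact: okw.
Qed.

(** One term of a linear inequality: a signed coefficient, the hypothesis whose probability is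
    taken, and the family of events. Terms of one list may differ in all three. *)
Record wfam := Wfam { wcoef : R ; widx : nat ; widx_le : (widx <= K)%N ;
  wfun : nat -> set Omega ; wfunP : adapted wfun }.

Let integrable_LR j t A : (j <= K)%N -> past t A ->
  (P 0%N).-integrable setT (fun w => (LR f X j t w * \1_A w)%:E) /\
  (\int[P 0%N]_w (LR f X j t w * \1_A w)%:E = (prob j A)%:E)%E.
Proof.
move=> jK pA.
have mA := past_measurable _ _ pA.
have mLA : measurable_fun setT (fun w => LR f X j t w * \1_A w).
  apply: measurable_funM; last exact: measurable_indic.
  exact: past_fun_measurable (LR_past _ _ t jK (leqnn _)).
have L0 w : 0 <= LR f X j t w * \1_A w by rewrite mulr_ge0 ?LR_ge0// indicE.
have E : (\int[P 0%N]_w (LR f X j t w * \1_A w)%:E = (prob j A)%:E)%E.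
  rewrite -probE// (change_of_measure _ _ _ jK pA) [RHS]integral_mkcond.
  apply: eq_integral => w _; rewrite patchE indicE.
  by case: (_ \in _); rewrite ?mulr1 ?mulr0.
split => //; apply/integrableP; split; first exact/measurable_EFinP.
under eq_integral do rewrite abse_EFin ger0_norm//.
by rewrite E ltry.
Qed.

Let comparison_at (s : seq wfam) t :
  (forall w, ok_upto t w -> 0 <= \sum_(x <- s) wcoef x * (LR f X (widx x) t w * \1_(wfun x t) w)) ->
  0 <= \sum_(x <- s) wcoef x * prob (widx x) (wfun x t).
Proof.
move=> H.
(* Intersecting with [ok_upto t] changes no probability and makes the inequality hold everywhere. *)
have {}H w : 0 <= \sum_(x <- s) wcoef x *
    (LR f X (widx x) t w * \1_(wfun x t `&` ok_upto t) w).
  have [okw|nokw] := pselect (ok_upto t w); last first.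
    rewrite big1// => x _; rewrite indicE memNset ?mulr0//.
    by move=> [].
  have o1 : \1_(ok_upto t) w = 1 :> R by rewrite indicE mem_set.
  under eq_bigr do rewrite indicI /= o1 mulr1.
  exact: H.
have pG x : past t (wfun x t `&` ok_upto t).
  by apply: pastI => //; case: (wfunP x).
suff [_ E] : (P 0%N).-integrable setT (fun w => (\sum_(x <- s) wcoef x *
    (LR f X (widx x) t w * \1_(wfun x t `&` ok_upto t) w))%:E) /\
  (\int[P 0%N]_w (\sum_(x <- s) wcoef x *
    (LR f X (widx x) t w * \1_(wfun x t `&` ok_upto t) w))%:E =
   (\sum_(x <- s) wcoef x * prob (widx x) (wfun x t))%:E)%E.
  by rewrite -lee_fin -E; apply: integral_ge0 => w _; rewrite lee_fin.
elim: s {H} => [|x s [IH1 IH2]].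
  under eq_fun do rewrite big_nil.
  by rewrite big_nil integral0; split => //; exact: integrable0.
under eq_fun do rewrite big_cons EFinD.
have [I1 I2] := integrable_LR _ _ _ (widx_le x) (pG x).
have I3 : (P 0%N).-integrable setT (fun w => (wcoef x *
    (LR f X (widx x) t w * \1_(wfun x t `&` ok_upto t) w))%:E).
  under eq_fun do rewrite EFinM.
  exact: integrableZl.
split; first exact: integrableD.
rewrite integralD// IH2 big_cons EFinD; congr (_ + _)%E.
under eq_integral do rewrite EFinM.
rewrite integralZl// I2 -EFinM prob_ok_upto//; first exact: widx_le.
by case: (wfunP x).
Qed.

(** The coefficients have signs, which excludes monotone convergence of the whole sum. Each term is
    instead the limit of its partial sums over time by countable additivity, and the inequality,
    valid at each time, passes to the limit. *)
Lemma comparison (s : seq wfam) :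
  (forall t w, ok_upto t w -> 0 <= \sum_(x <- s) wcoef x * (LR f X (widx x) t w * \1_(wfun x t) w)) ->
  0 <= \sum_(x <- s) wcoef x * prob (widx x) (\bigcup_t wfun x t).
Proof.
move=> H.
have cv : (fun n => \sum_(x <- s) wcoef x * \sum_(0 <= t < n) prob (widx x) (wfun x t))
    @ \oo --> \sum_(x <- s) wcoef x * prob (widx x) (\bigcup_t wfun x t).
  elim: s {H} => [|x s IH].
    by under eq_fun do rewrite big_nil; rewrite big_nil; exact: cvg_cst.
  under eq_fun do rewrite big_cons; rewrite big_cons.
  apply: cvgD => //; apply: cvgM; first exact: cvg_cst.
  have [pG tG] := wfunP x.
  have mG t := past_measurable _ _ (pG t).
  apply: (@fine_cvg _ _ _ _ (fun n => (\sum_(0 <= t < n) prob (widx x) (wfun x t))%:E)).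
  rewrite -probE; last exact: adapted_measurable (wfunP x).
  rewrite (_ : (fun n => _) = (fun n => \sum_(0 <= t < n) P (widx x) (wfun x t))%E).
    exact: measure_sigma_additive.
  by apply/funext => n; rewrite -sumEFin; apply: eq_bigr => t _; rewrite -probE.
rewrite -(cvg_lim (@Rhausdorff R) cv); apply: limr_ge; first by apply/cvg_ex; eexists; exact: cv.
apply: nearW => n; under eq_bigr do rewrite mulr_sumr.
rewrite exchange_big/=; apply: sumr_ge0 => t _; exact: comparison_at (H t).
Qed.

Lemma big_nat1_ord (F : nat -> R) : \sum_(1 <= i < K.+1) F i = \sum_(l < K) F l.+1.
Proof. by rewrite big_add1 big_mkord. Qed.

Lemma LR_gt0 i t w : (i <= K)%N -> ok_upto t w -> 0 < LR f X i t w.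
Proof.
move=> iK okw; apply: prodr_gt0 => k _; have Dk := D0 _ (okw k (ltn_ord k)).
by rewrite divr_gt0// (supp i).
Qed.

Lemma LR_0 t w : ok_upto t w -> LR f X 0 t w = 1.
Proof.
move=> okw; rewrite /LR big1// => k _.
by rewrite divff// gt_eqF// D0//; apply: okw.
Qed.

Lemma compare_prob i j a b G : (i <= K)%N -> (j <= K)%N -> adapted G ->
  (forall t w, ok_upto t w -> G t w -> a * LR f X i t w <= b * LR f X j t w) ->
  a * prob i (\bigcup_t G t) <= b * prob j (\bigcup_t G t).
Proof.
move=> iK jK aG H.
have := comparison [:: Wfam b j jK G aG; Wfam (- a) i iK G aG].
rewrite !big_cons big_nil/= addr0 mulNr subr_ge0; apply => t w okw.
rewrite !big_cons big_nil/= addr0 mulNr subr_ge0 !mulrA.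
rewrite indicE; have [Gw|nGw] := pselect (G t w).
  by rewrite mem_set// !mulr1 H.
by rewrite memNset// !mulr0.
Qed.

Lemma compare_prob_at i j a b t A : (i <= K)%N -> (j <= K)%N -> past t A ->
  (forall w, ok_upto t w -> A w -> a * LR f X i t w <= b * LR f X j t w) ->
  a * prob i A <= b * prob j A.
Proof.
move=> iK jK pA H.
have := compare_prob _ _ a b _ iK jK (adapted_at _ _ pA).
rewrite bigcup_at; apply => s w okw; case: eqP => // st; rewrite st in okw *.
exact: H.
Qed.

Lemma compare_prob_mix a (q : nat -> R) G : adapted G ->
  (forall t w, ok_upto t w -> G t w -> a <= mixLR K f X q t w) ->
  a * prob 0 (\bigcup_t G t) <= \sum_(1 <= i < K.+1) q i * prob i (\bigcup_t G t).
Proof.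
move=> aG H.
have := comparison (Wfam (- a) 0 (leq0n K) G aG ::
  [seq Wfam (q l.+1) l.+1 (ltn_ord l) G aG | l : 'I_K]).
rewrite big_cons big_map big_enum/= mulNr addrC subr_ge0 big_nat1_ord; apply => t w okw.
rewrite big_cons big_map big_enum/= mulNr addrC subr_ge0 LR_0// mul1r.
under eq_bigr do rewrite mulrA.
rewrite -mulr_suml; have [Gw|nGw] := pselect (G t w).
  by rewrite indicE mem_set// !mulr1; have := H t w okw Gw; rewrite /mixLR big_nat1_ord.
by rewrite indicE memNset// !mulr0.
Qed.

(** * Stopping, and error bounds valid at every threshold *)

Section stopping.
Variables (U L : nat -> Omega -> R) (A B : R).
Hypotheses (pU : forall t, past_fun t (U t)) (pL : forall t, past_fun t (L t)).

(** Families are indexed from 0 while the tests start at time 1; the clause [1 <= t] empties the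
    member at 0. *)
Definition stop_set t : set Omega := [set w | (1 <= t)%N /\ stop_cond U L A B t w].
Definition accepted1 t : set Omega := seqDU stop_set t `&` [set w | B <= U t w].
Definition accepted0 t : set Omega := seqDU stop_set t `&` [set w | U t w < B].

Lemma stop_set_past t : past t (stop_set t).
Proof.
apply: (pastI _ [set _ | _] (stop_cond U L A B t)); first exact: past_prop.
apply: (pastU _ [set w | _ <= _] [set w | _ <= _]); apply: past_fun_le => //;
  exact: past_fun_cst.
Qed.

Lemma seqDU_stop_set t w : seqDU stop_set t w <-> stops_at U L A B t w.
Proof.
rewrite /seqDU -bigcup_mkord; split.
  move=> [[t1 St] nS]; split => //; split => // s s1 st Ss; apply: nS.
  by exists s => //; split.
by move=> [t1 [St nS]]; split; [split|move=> [s /= st [s1 Ss]]; exact: (nS s)].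
Qed.

Lemma accept1E : accept1 U L A B = \bigcup_t accepted1 t.
Proof.
apply/seteqP; split => w.
  by move=> [t [/seqDU_stop_set St BU]]; exists t => //; split.
by move=> [t _ [/seqDU_stop_set St BU]]; exists t; split.
Qed.

Lemma accept0E : accept0 U L A B = \bigcup_t accepted0 t.
Proof.
apply/seteqP; split => w.
  by move=> [t [/seqDU_stop_set St BU]]; exists t => //; split.
by move=> [t _ [/seqDU_stop_set St BU]]; exists t; split.
Qed.

Lemma accepted1_adapted : adapted accepted1.
Proof.
apply: adaptedI; first exact: adapted_first stop_set_past.
by move=> t; apply: past_fun_le => //; exact: past_fun_cst.
Qed.

Lemma accepted0_adapted : adapted accepted0.
Proof.
apply: adaptedI; first exact: adapted_first stop_set_past.
by move=> t; apply: past_fun_lt => //; exact: past_fun_cst.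
Qed.

Lemma accepted0_le t w : accepted0 t w -> (1 <= t)%N /\ L t w <= A^-1.
Proof.
move=> [[[t1 [BU|]]]] //= _; by rewrite ltNge BU.
Qed.

(** On acceptance of [H_1] the mixture is at least [B], so [B] times the [P_0]-probability is at
    most the [q]-weighted sum of probabilities under the alternatives. Asking only that [U] lie
    below the mixture covers both tests. *)
Lemma false_alarm_le (q : nat -> R) : 0 < B ->
  (forall i, (1 <= i <= K)%N -> 0 < q i) ->
  (forall t w, U t w <= mixLR K f X q t w) ->
  prob 0 (accept1 U L A B) <= wnorm K q / B.
Proof.
move=> B0 q0 Uq; rewrite ler_pdivlMr// mulrC accept1E.
have aG := accepted1_adapted.
apply: (@le_trans _ _ (\sum_(1 <= i < K.+1) q i * prob i (\bigcup_t accepted1 t))).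
  by apply: compare_prob_mix => // t w _ [_ /= BU]; exact: le_trans (Uq _ _).
rewrite /wnorm !big_nat1_ord ler_sum// => l _.
rewrite -[leRHS]mulr1 ler_wpM2l//.
  by rewrite ltW// q0// ltn_ord.
by apply: prob_le1; exact: adapted_measurable.
Qed.

(** On acceptance of [H_0] one has [A * q i * LR_i <= 1]. Both the mixture and the maximum can serve
    as [L]. *)
Lemma missed_detection_le (q : nat -> R) i : 0 < A -> (1 <= i <= K)%N -> 0 < q i ->
  (forall t w, q i * LR f X i t w <= L t w) ->
  prob i (accept0 U L A B) <= (A * q i)^-1.
Proof.
move=> A0 /andP[i1 iK] qi Lq; rewrite -[leRHS]mul1r ler_pdivlMr ?mulr_gt0// mulrC accept0E.
have aG := accepted0_adapted.
apply: (@le_trans _ _ (1 * prob 0 (\bigcup_t accepted0 t))); last first.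
  by rewrite mul1r prob_le1//; exact: adapted_measurable.
apply: compare_prob => // t w okw /accepted0_le[t1 LA].
rewrite LR_0// mulr1 -mulrA -ler_pdivlMl// mulr1.
exact: le_trans (Lq _ _) LA.
Qed.

End stopping.

(** * Adaptedness and elementary bounds of the two statistics *)

Lemma mixLR_past q t : past_fun t (mixLR K f X q t).
Proof.
apply: past_fun_sum => i; rewrite mem_index_iota ltnS => /andP[_ iK].
by apply: past_funM; [exact: past_fun_cst|exact: LR_past].
Qed.

Lemma maxLR_past q t : past_fun t (maxLR K f X q t).
Proof.
apply: past_fun_bigmax => i; rewrite mem_index_iota ltnS => /andP[_ iK].
by apply: past_funM; [exact: past_fun_cst|exact: LR_past].
Qed.

Section weights.
Variable q : nat -> R.
Hypothesis q0 : forall i, (1 <= i <= K)%N -> 0 < q i.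

Lemma le_maxLR i t w : (1 <= i <= K)%N -> q i * LR f X i t w <= maxLR K f X q t w.
Proof.
move=> iK; rewrite /maxLR.
apply: (le_bigmax_seq 0 i xpredT (fun i => q i * LR f X i t w)) => //.
by rewrite mem_index_iota ltnS.
Qed.

Lemma le_mixLR i t w : (1 <= i <= K)%N -> q i * LR f X i t w <= mixLR K f X q t w.
Proof.
move=> /andP[i1 iK]; rewrite /mixLR big_nat1_ord.
have i'K : (i.-1 < K)%N by rewrite prednK.
rewrite (bigD1 (Ordinal i'K))//= prednK// lerDl; apply: sumr_ge0 => l _.
by rewrite mulr_ge0 ?LR_ge0// ?ltn_ord// ltW// q0// ltn_ord.
Qed.

Lemma maxLR_le_mixLR t w : maxLR K f X q t w <= mixLR K f X q t w.
Proof.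
rewrite /maxLR big_seq; apply: bigmax_le.
  rewrite /mixLR big_nat1_ord; apply: sumr_ge0 => l _.
  by rewrite mulr_ge0 ?LR_ge0// ?ltn_ord// ltW// q0// ltn_ord.
by move=> i; rewrite mem_index_iota ltnS => iK; exact: le_mixLR.
Qed.

End weights.

(** * Overshoot and crossing probabilities *)

Section overshoot.
Variables (ia ib : nat) (S : nat -> Omega -> R).
Hypotheses (iaK : (ia <= K)%N) (ibK : (ib <= K)%N) (pS : forall t, past_fun t (S t)).
Hypothesis LRS : forall t w, ok_upto t w -> LR f X ia t w = expR (S t w) * LR f X ib t w.

Definition above (c : R) (t : nat) : set Omega := [set w | c <= S t w].

Definition crossing c : nat -> set Omega := seqDU (above c).

Lemma crossing_adapted c : adapted (crossing c).
Proof. by apply: adapted_first => t; apply: past_fun_le => //; exact: past_fun_cst. Qed.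

Lemma crossingP c t w : crossing c t w <->
  c <= S t w /\ forall s, (s < t)%N -> S s w < c.
Proof.
rewrite /crossing /seqDU -bigcup_mkord; split => -[cS H]; split => //.
  by move=> s st; rewrite ltNge; apply/negP => cs; apply: H; exists s.
by move=> [s /= st]; apply/negP; rewrite -ltNge; exact: H.
Qed.

Lemma bigcup_crossing c : \bigcup_t crossing c t = [set w | exists t, c <= S t w].
Proof.
rewrite -seqDU_bigcup_eq; apply/seteqP; split => w.
  by move=> [t _ cS]; exists t.
by move=> [t cS]; exists t.
Qed.

Let over c x t := crossing c t `&` [set w | S t w - c <= x].

Let over_adapted c x : adapted (over c x).
Proof.
apply: adaptedI; first exact: crossing_adapted.
move=> t; rewrite (_ : [set w | _] = [set w | S t w <= x + c]).
  by apply: past_fun_le => //; exact: past_fun_cst.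
by apply/seteqP; split => w /=; rewrite lerBlDr.
Qed.

Let bigcup_over c x : upper_overshoot_le S c x = \bigcup_t over c x t.
Proof.
apply/seteqP; split => w.
  by move=> [t [cS [H Sx]]]; exists t => //; split => //; apply/crossingP.
by move=> [t _ [/crossingP[cS H] Sx]]; exists t.
Qed.

(** At the crossing time [LR_ib = expR (- c) * expR (- (S - c)) * LR_ia], so the middle term is the
    [P_ia]-mean of the exponential of minus the overshoot on the crossing event. Replacing that
    exponential by [exp_step] leaves finite combinations, to which [comparison] applies;
    [expR (- (N * eta))] pays for cutting the lattice after [N] steps. *)
Let overshoot_bounds eta N c A : 0 <= eta ->
  A = \sum_(k < N) step_weight eta k *
        prob ia (upper_overshoot_le S c (k.+1%:R * eta)) ->
  expR (- eta) * A <= expR c * prob ib [set w | exists t, c <= S t w] <=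
    A + expR (- (N%:R * eta)).
Proof.
move=> eta0 AE; rewrite -bigcup_crossing.
have {AE}-> : A = \sum_(k < N) step_weight eta k * prob ia (\bigcup_t over c (k.+1%:R * eta) t).
  by rewrite AE; apply: eq_bigr => k _; rewrite bigcup_over.
have aC := crossing_adapted c.
have key t w : ok_upto t w -> \sum_(k < N) step_weight eta k *
    (LR f X ia t w * \1_(over c (k.+1%:R * eta) t) w) =
    exp_step eta N (S t w - c) * LR f X ia t w * \1_(crossing c t) w.
  move=> okw; rewrite /exp_step !mulr_suml; apply: eq_bigr => k _.
  rewrite -!mulrA; congr (_ * _); rewrite mulrCA; congr (_ * _).
  rewrite /over indicI/= mulrC; congr (_ * _).
  by rewrite indicE mem_setE.
have LRSc t w : ok_upto t w -> LR f X ia t w = expR (S t w - c) * (expR c * LR f X ib t w).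
  by move=> okw; rewrite LRS// mulrA -expRD subrK.
apply/andP; split.
- have := comparison (Wfam (expR c) ib ibK _ aC ::
    [seq Wfam (- (expR (- eta) * step_weight eta k)) ia iaK _
       (over_adapted c (k.+1%:R * eta)) | k : 'I_N]).
  rewrite big_cons big_map big_enum/= => H.
  have {}H : 0 <= expR c * prob ib (\bigcup_t crossing c t) +
    \sum_(k < N) - (expR (- eta) * step_weight eta k) *
      prob ia (\bigcup_t over c (k.+1%:R * eta) t).
    apply: H => t w okw; rewrite big_cons big_map big_enum/=.
    under eq_bigr do rewrite mulNr -mulrA.
    rewrite sumrN -mulr_sumr key// subr_ge0 !mulrA.
    have [Cw|nCw] := pselect (crossing c t w); last by rewrite indicE memNset// !mulr0.
    rewrite indicE mem_set// !mulr1 LRSc//.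
    have Lb : 0 <= expR c * LR f X ib t w by rewrite mulr_ge0 ?expR_ge0 ?LR_ge0.
    rewrite mulrA -[leRHS]mul1r ler_wpM2r//.
    rewrite -[leRHS](expRxMexpNx_1 (S t w - c)) [leLHS]mulrC ler_wpM2l ?expR_ge0//.
    exact: exp_step_le.
  rewrite -subr_ge0; apply: le_trans H _; rewrite lerD2l mulr_sumr -sumrN.
  by apply: ler_sum => k _; rewrite mulNr mulrA.
- have := comparison (Wfam (- expR c) ib ibK _ aC ::
    Wfam (expR (- (N%:R * eta))) ia iaK _ aC ::
    [seq Wfam (step_weight eta k) ia iaK _
       (over_adapted c (k.+1%:R * eta)) | k : 'I_N]).
  rewrite !big_cons big_map big_enum/= => H.
  have {}H : 0 <= - expR c * prob ib (\bigcup_t crossing c t) +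
    (expR (- (N%:R * eta)) * prob ia (\bigcup_t crossing c t) +
    \sum_(k < N) step_weight eta k * prob ia (\bigcup_t over c (k.+1%:R * eta) t)).
    apply: H => t w okw; rewrite !big_cons big_map big_enum/= key//.
    have [Cw|nCw] := pselect (crossing c t w); last first.
      by rewrite indicE memNset// !mulr0 !addr0.
    rewrite indicE mem_set// !mulr1 mulNr addrC subr_ge0 -mulrDl LRSc//.
    have Lb : 0 <= expR c * LR f X ib t w by rewrite mulr_ge0 ?expR_ge0 ?LR_ge0.
    rewrite mulrA -[leLHS]mul1r ler_wpM2r//.
    rewrite -[leLHS](expRxMexpNx_1 (S t w - c)) [leRHS]mulrC ler_wpM2l ?expR_ge0//.
    have ov0 : 0 <= S t w - c by rewrite subr_ge0; case/crossingP: Cw.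
    have := exp_step_ge _ N _ eta0 ov0. lra.
  have h : prob ia (\bigcup_t crossing c t) <= 1.
    by apply: prob_le1; exact: adapted_measurable.
  have := ler_wpM2l (expR_ge0 (- (N%:R * eta))) h.
  by move: H; rewrite mulNr; lra.
Qed.

(** [overshoot_bounds] and [overshoot_const_bounds] involve the same step sums, once with overshoot
    probabilities and once with their limits. False alarms use hypotheses [i] and 0 with [S = Z^i];
    missed detections use 0 and 1 with [S = - Z^1]. *)
Lemma overshoot_limit (mu : probability R R) :
  is_limit_overshoot (P ia) (upper_overshoot_le S) mu ->
  forall eps, 0 < eps -> exists C, forall c, C < c ->
    `|expR c * prob ib [set w | exists t, c <= S t w] - overshoot_const mu| <= eps.
Proof.
move=> [mu0 lim] eps eps0.
(* One third each for the lattice factor [expR (- eta) >= 1 - eta], the cut-off term, and the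
   distance between the two step sums. *)
pose eta := eps / 3.
have eta0 : 0 < eta by rewrite divr_gt0.
have [N hN] := expR_lattice_small eta eta eta0 eta0.
pose A c := \sum_(k < N) step_weight eta k *
             prob ia (upper_overshoot_le S c (k.+1%:R * eta)).
pose Am := \sum_(k < N) step_weight eta k * cdf_le mu (k.+1%:R * eta).
have mo c x : measurable (upper_overshoot_le S c x).
  by rewrite bigcup_over; exact: adapted_measurable (over_adapted c x).
have cvA : A c @[c --> +oo] --> Am.
  apply: cvg_big => [|k _]; first exact: add_continuous.
  apply: cvgM; first exact: cvg_cst.
  have k0 : 0 < k.+1%:R * eta by rewrite mulr_gt0.
  apply: (@fine_cvg _ _ _ _ (fun c => P ia (upper_overshoot_le S c (k.+1%:R * eta)))).
  rewrite /cdf_le fineK; first exact: lim.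
  by apply: fin_num_measure; exact: measurable_itv.
have [C [_ hC]] : \forall c \near +oo, `|Am - A c| <= eta.
  by move/cvgrPdist_le : cvA; exact.
exists C => c Cc.
have hA : `|Am - A c| <= eta by apply: hC.
have eta0' := ltW eta0.
have /andP[h1 h2] := overshoot_const_bounds _ mu0 _ N eta0'.
have /andP[h3 h4] := overshoot_bounds _ N c _ eta0' erefl.
have w1 := sum_step_weight _ N eta0'.
have le1 (g : nat -> R) : (forall k, g k <= 1) ->
    \sum_(k < N) step_weight eta k * g k <= 1.
  move=> g1; apply: le_trans w1; apply: ler_sum => k _.
  by rewrite -[leRHS]mulr1 ler_wpM2l ?step_weight_ge0.
have Am1 : Am <= 1.
  apply: (le1 (fun k => cdf_le mu (k.+1%:R * eta))) => k.
  have mI : measurable (`]-oo, (k.+1%:R * eta)]%classic : set R) by exact: measurable_itv.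
  by rewrite /cdf_le -lee_fin fineK ?fin_num_measure// probability_le1.
have Ac1 : A c <= 1.
  by apply: (le1 (fun k => prob ia (upper_overshoot_le S c (k.+1%:R * eta)))) => k; exact: prob_le1.
have ee : 1 - eta <= expR (- eta) by have := expR_ge1Dx (- eta).
have Am0 : 0 <= Am.
  by apply: sumr_ge0 => k _; rewrite mulr_ge0 ?step_weight_ge0// fine_ge0.
have Ac0 : 0 <= A c.
  by apply: sumr_ge0 => k _; rewrite mulr_ge0 ?step_weight_ge0// prob_ge0.
have e3 : eps = eta * 3 by rewrite /eta divfK.
have g1 : (1 - eta) * Am <= overshoot_const mu.
  by apply: le_trans h1; rewrite ler_wpM2r.
have g2 : (1 - eta) * A c <= expR c * prob ib [set w | exists t, c <= S t w].
  by apply: le_trans h3; rewrite ler_wpM2r.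
have m1 : eta * Am <= eta by rewrite -[leRHS]mulr1 ler_wpM2l.
have m2 : eta * A c <= eta by rewrite -[leRHS]mulr1 ler_wpM2l.
move: h4 h2 g1 g2 hA hN; rewrite -/(A c) -/Am !mulrBl !mul1r !ler_norml e3.
move=> h4 h2 g1 g2 /andP[a1 a2] hN.
by apply/andP; split; lra.
Qed.

End overshoot.

Lemma prob_bigcup_le i (A : nat -> set Omega) C : (forall t, measurable (A t)) ->
  (forall n, \sum_(t < n) prob i (A t) <= C) -> prob i (\bigcup_t A t) <= C.
Proof.
move=> mA H; rewrite -lee_fin -probE; last exact: bigcupT_measurable.
apply: (@le_trans _ _ (\sum_(0 <= t <oo) P i (A t))%E).
  by apply: measure_sigma_subadditive => //; exact: bigcupT_measurable.
apply: lime_le; first exact: is_cvg_nneseries.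
apply: nearW => n; rewrite big_mkord.
under eq_bigr do rewrite probE//.
by rewrite sumEFin lee_fin.
Qed.

(** * Likelihood ratios of distinct densities vanish *)

Section hellinger.
Variables i j : nat.
Hypotheses (iK : (i <= K)%N) (jK : (j <= K)%N).
Hypothesis fij : nu [set x | f j x != f i x] != 0%E.

Let g x := Num.sqrt (f j x / f i x).

Let mg : measurable_fun setT g.
Proof.
apply: (measurableT_comp (continuous_measurable_fun (@sqrt_continuous R))).
apply: measurable_funM; first exact: mf.
by apply: measurable_fun_inv_ge0; [move=> x; exact: f0|exact: mf].
Qed.

Let g0 x : 0 <= g x. Proof. exact: sqrtr_ge0. Qed.

Let fi_fj0 x : f i x = 0 -> f j x = 0.
Proof.
move=> fi; apply/eqP; rewrite eq_le f0// andbT leNgt supp// -(supp i)// fi ltxx//.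
Qed.

Let g2 x : f i x * g x ^+ 2 = f j x.
Proof.
rewrite /g sqr_sqrtr ?divr_ge0 ?f0//.
have [/[dup] fi /fi_fj0 ->|fi] := eqVneq (f i x) 0; first by rewrite !mul0r mulr0.
by rewrite mulrC divfK.
Qed.

(** Integrand of the squared Hellinger distance: as [(1 - g)^2 / 2 + g = (1 + g^2) / 2], its
    integral is 1 minus the affinity [beta]. *)
Let h x := f i x * (1 - g x) ^+ 2 / 2.

Let h0 x : 0 <= h x.
Proof. by rewrite divr_ge0// mulr_ge0 ?f0// sqr_ge0. Qed.

Let mh : measurable_fun setT h.
Proof.
apply: measurable_funM => //; apply: measurable_funM; first exact: mf.
by apply: measurable_funX; apply: measurable_funB.
Qed.

Let beta := fine (\int[nu]_x (f i x * g x)%:E).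

Let fig0 x : 0 <= f i x * g x. Proof. by rewrite mulr_ge0 ?f0. Qed.

Let mfig : measurable_fun setT (fun x => f i x * g x).
Proof. by apply: measurable_funM => //; exact: mf. Qed.

Let int_h : (\int[nu]_x (h x)%:E + \int[nu]_x (f i x * g x)%:E = 1)%E.
Proof.
rewrite -ge0_integralD//; last 4 first.
- by move=> x _; rewrite lee_fin.
- exact/measurable_EFinP.
- by move=> x _; rewrite lee_fin.
- exact/measurable_EFinP.
transitivity (\int[nu]_x (2^-1%:E * ((f i x)%:E + (f j x)%:E)))%E.
  apply: eq_integral => x _; rewrite -!EFinD -EFinM; congr EFin.
  by rewrite -(g2 x) /h; field.
have [_ [_ Ii]] := dens i iK; have [_ [_ Ij]] := dens j jK.
have mi : measurable_fun setT (EFin \o f i) by apply/measurable_EFinP; exact: mf.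
have mj : measurable_fun setT (EFin \o f j) by apply/measurable_EFinP; exact: mf.
have fi0 x : [set: T] x -> (0 <= (f i x)%:E)%E by rewrite lee_fin f0.
have fj0 x : [set: T] x -> (0 <= (f j x)%:E)%E by rewrite lee_fin f0.
rewrite ge0_integralZl_EFin//.
- by rewrite ge0_integralD// Ii Ij -EFinD -EFinM -[1 + 1]/(2%:R) mulVf.
- by move=> x _; rewrite adde_ge0// lee_fin f0.
- exact: emeasurable_funD.
Qed.

Let int_h0 : (0 <= \int[nu]_x (h x)%:E)%E.
Proof. by apply: integral_ge0 => x _; rewrite lee_fin. Qed.

Let int_g0 : (0 <= \int[nu]_x (f i x * g x)%:E)%E.
Proof. by apply: integral_ge0 => x _; rewrite lee_fin. Qed.

Let int_g_fin : (\int[nu]_x (f i x * g x)%:E)%E \is a fin_num.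
Proof.
rewrite ge0_fin_numE//; apply: (@le_lt_trans _ _ 1%E); last exact: ltry.
by rewrite -int_h leeDr.
Qed.

Let beta_ge0 : 0 <= beta. Proof. exact: fine_ge0. Qed.

(** If [beta] were 1, [h] would vanish almost everywhere, and [f i] and [f j] would agree almost
    everywhere. *)
Let beta_lt1 : beta < 1.
Proof.
rewrite lt_neqAle -lee_fin fineK//; apply/andP; split; last by rewrite -int_h leeDr.
apply/negP => /eqP b1.
have int_h_eq0 : (\int[nu]_x (h x)%:E = 0)%E.
  move: int_h; rewrite -(fineK int_g_fin) -/beta b1 => H.
  have : (\int[nu]_x (h x)%:E)%E \is a fin_num.
    rewrite ge0_fin_numE//; apply: (@le_lt_trans _ _ 1%E); last exact: ltry.
    by rewrite -H leeDl.
  move=> fn; move: H; rewrite -(fineK fn) -EFinD => -[H]; congr EFin.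
  by apply: (addIr 1); rewrite add0r.
have : ae_eq nu setT (EFin \o h) (cst 0%E).
  apply/(ae_eq_integral_abs nu measurableT); first exact/measurable_EFinP.
  rewrite -int_h_eq0; apply: eq_integral => x _.
  by rewrite /= ger0_norm.
move=> [N [mN N0 hN]]; move/negP: fij; apply.
apply/eqP; apply: measure_negligible.
  by apply: measurable_neq; exact: mf.
exists N; split => // x /= fne; apply: hN => /= /(_ I) [] hx.
move/negP: fne; apply; apply/eqP.
move/eqP: hx; rewrite /h !mulf_eq0 invr_eq0 pnatr_eq0 orbF orbb subr_eq0.
move=> /orP[/eqP fi|/eqP g1]; first by rewrite fi fi_fj0.
by rewrite -(g2 x) -g1 expr1n mulr1.
Qed.

(** Under [P_i] the square root of [LR_j / LR_i] has mean [beta ^+ t]; Markov's inequality bounds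
    the event at time [t] by [beta ^+ t / sqrt delta], and these bounds form a convergent geometric
    series. *)
Lemma likelihood_ratio_vanish delta eps : 0 < delta -> 0 < eps ->
  exists m0 : nat, forall m, (m0 <= m)%N ->
    prob i [set w | exists t, (m <= t)%N /\ delta * LR f X i t w < LR f X j t w] <= eps.
Proof.
move=> d0 e0.
pose G t : Omega -> R := fun w => \prod_(k < t) g (X k w).
have G0 t w : 0 <= G t w by apply: prodr_ge0.
have EG t : (\int[P i]_w (G t w)%:E = (beta ^+ t)%:E)%E.
  rewrite (iid_integral_prod _ _ _ _ (dens i iK) (iidX i iK) t (fun=> g))//.
    by rewrite prodr_const card_ord.
  by move=> k; move: int_g_fin; rewrite fin_numElt => /andP[].
have mG t : measurable_fun setT (G t).
  by apply: measurable_prod => k _; exact: measurableT_comp mg (mX k).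
have GLR t w : ok_upto t w -> G t w ^+ 2 * LR f X i t w = LR f X j t w.
  move=> okw; rewrite /G /LR -prodrXl -big_split/=; apply: eq_bigr => k _.
  by rewrite mulrA [_ * f i _]mulrC g2.
pose s := Num.sqrt delta.
have s0 : 0 < s by rewrite sqrtr_gt0.
pose A t := [set w | delta * LR f X i t w < LR f X j t w].
have pA t : past t (A t).
  by apply: past_fun_lt; [apply: past_funM; [exact: past_fun_cst|exact: LR_past]|exact: LR_past].
have mA t : measurable (A t) := past_measurable _ _ (pA t).
have PA t : prob i (A t) <= beta ^+ t / s.
  have mB : measurable [set w | s <= G t w].
    rewrite -[X in measurable X]setTI; apply: measurable_fun_le => //.
  apply: (@le_trans _ _ (prob i [set w | s <= G t w])).
    apply: prob_mono_ok => // w [Aw okw].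
    have okt : ok_upto t w by move=> k _; exact: okw.
    move: Aw; rewrite /A /= -GLR// ltr_pM2r ?LR_gt0// => dG.
    rewrite -(ger0_norm (G0 t w)) -sqrtr_sqr; apply: ler_wsqrtr; exact: ltW.
  by apply: prob_markov => //; rewrite EG.
have b1 : 0 < 1 - beta by rewrite subr_gt0.
have geo n : \sum_(t < n) beta ^+ t <= (1 - beta)^-1.
  elim: n => [|n IH]; first by rewrite big_ord0 invr_ge0 ltW.
  rewrite big_ord_recl expr0; under eq_bigr do rewrite exprS.
  have E : (1 - beta)^-1 = 1 + beta * (1 - beta)^-1.
    by field; rewrite gt_eqF.
  by rewrite -mulr_sumr [leRHS]E lerD2l ler_wpM2l.
have : (fun m => beta ^+ m) @ \oo --> (0 : R).
  by apply: cvg_expr; rewrite ger0_norm.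
(* The series from [m] on is at most [beta ^+ m / (s * (1 - beta))]; this tolerance turns it into
   [eps]. *)
move/cvgrPdist_le => /(_ (eps * s * (1 - beta))).
move=> /(_ (mulr_gt0 (mulr_gt0 e0 s0) b1)) [m0 _ hm0]; exists m0 => m m0m.
have bm : beta ^+ m <= eps * s * (1 - beta).
  have := hm0 m m0m; rewrite /= sub0r normrN ger0_norm//; exact: exprn_ge0.
rewrite (_ : [set w | _] = \bigcup_t A (m + t)%N); last first.
  apply/seteqP; split => w.
    by move=> [t [mt Aw]]; exists (t - m)%N => //; rewrite subnKC.
  by move=> [t _ Aw]; exists (m + t)%N; split => //; exact: leq_addr.
apply: prob_bigcup_le => // n.
apply: (@le_trans _ _ (\sum_(t < n) beta ^+ m / s * beta ^+ t)).
  by apply: ler_sum => t _; rewrite mulrAC -exprD.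
rewrite -mulr_sumr.
apply: (@le_trans _ _ (beta ^+ m / s * (1 - beta)^-1)).
  by rewrite ler_wpM2l// divr_ge0 ?exprn_ge0// ltW.
by rewrite ler_pdivrMr// ler_pdivrMr// mulrAC.
Qed.

End hellinger.

(** * Weak law of large numbers *)

Section weak_law.
Variables (j : nat) (h : T -> R).
Hypotheses (jK : (j <= K)%N) (mh : measurable_fun setT h)
  (ih : (P j).-integrable setT (fun w => (h (X 0%N w))%:E)).

Let tr (L : R) x := h x * \1_[set y | `|h y| <= L] x.

Let mtr L : measurable_fun setT (tr L).
Proof.
apply: measurable_funM => //; apply: measurable_indic.
rewrite -[X in measurable X]setTI; apply: measurable_fun_le => //.
exact: measurableT_comp.
Qed.

Let tr_in L x : `|h x| <= L -> tr L x = h x.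
Proof. by move=> hL; rewrite /tr indicE mem_set// mulr1. Qed.

Let tr_out L x : L < `|h x| -> tr L x = 0.
Proof.
by move=> hL; rewrite /tr indicE memNset ?mulr0//= => /(lt_le_trans hL); rewrite ltxx.
Qed.

Let tr_le L x : 0 <= L -> `|tr L x| <= L.
Proof.
move=> L0; have [hL|hL] := leP `|h x| L; first by rewrite tr_in.
by rewrite tr_out// normr0.
Qed.

Let norm_sub_tr L x : `|h x - tr L x| <= `|h x|.
Proof.
have [hL|hL] := leP `|h x| L; first by rewrite tr_in// subrr normr0.
by rewrite tr_out// subr0.
Qed.

Let norm_tr L x : `|tr L x| <= `|h x|.
Proof.
have [hL|hL] := leP `|h x| L; first by rewrite tr_in.
by rewrite tr_out// normr0.
Qed.

Let mX0 (u : T -> R) : measurable_fun setT u -> measurable_fun setT (u \o X 0%N).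
Proof. by move=> mu; exact: measurableT_comp mu (mX 0). Qed.

Let truncation_error delta : 0 < delta -> exists2 L : R, 0 < L &
  (\int[P j]_w (`|h (X 0%N w) - tr L (X 0%N w)|)%:E <= delta%:E)%E.
Proof.
move=> d0.
pose u n w := (`|h (X 0%N w) - tr n%:R (X 0%N w)|)%:E.
have mu n : measurable_fun setT (u n).
  apply/measurable_EFinP; apply: measurableT_comp => //.
  by apply: measurable_funB; apply: mX0.
have [] := @dominated_convergence _ _ _ (P j) setT measurableT u (cst 0%E)
  (fun w => `|(h (X 0%N w))%:E|%E) mu.
- exact: measurable_cst.
- apply/aeW => w _; apply: cvg_near_cst.
  exists (Num.truncn `|h (X 0%N w)|).+1 => // n /= hn.
  rewrite /u tr_in ?subrr ?normr0//.
  apply: le_trans (ltW (truncnS_gt _)) _; rewrite ler_nat//.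
- exact: integrable_abse.
- by apply/aeW => w n _; rewrite /u abse_EFin normr_id lee_fin norm_sub_tr.
move=> _ _; rewrite integral_cst// mul0e => /fine_cvgP[fin].
move/cvgrPdist_le => /(_ delta d0) [n1 _ hn1].
move: fin => [n2 _ hn2].
(* The successor makes the truncation level positive. *)
pose n := (maxn n1 n2).+1.
exists n%:R => //.
have f2 : (\int[P j]_w u n w)%E \is a fin_num := hn2 n (leq_trans (leq_maxr _ _) (leqnSn _)).
have := hn1 n (leq_trans (leq_maxl _ _) (leqnSn _)).
rewrite /= sub0r normrN => h1.
rewrite -(fineK f2) lee_fin; exact: le_trans (ler_norm _) h1.
Qed.

(** Only a first moment is available, so [h] is truncated: the bounded part has exponential moments,
    and the remainder has small mean. Lower tails are obtained by applying the statement to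
    [- h]. *)
Lemma weak_law_upper a eps : fine (\int[P j]_w (h (X 0%N w))%:E) < a -> 0 < eps ->
  exists n0 : nat, forall n, (n0 <= n)%N ->
    prob j [set w | n%:R * a <= \sum_(k < n) h (X k w)] <= eps.
Proof.
set m := fine _ => ma e0.
(* Four shares of the gap: the shift of the mean by truncation, the quadratic term of the
   exponential moment, the exponential decay rate, and the remainder. *)
pose eta := (a - m) / 4.
have eta0 : 0 < eta by rewrite divr_gt0// subr_gt0.
have aE : a = m + 4 * eta by rewrite /eta; field.
(* The first bound controls the shift of the mean; the second makes Markov's inequality for the
   remainder give [eps / 2]. *)
pose delta := Num.min eta (eta * (eps / 2)).
have e20 : 0 < eps / 2 by rewrite divr_gt0.
have d0 : 0 < delta by rewrite lt_min eta0 mulr_gt0.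
have [L L0 hL] := truncation_error _ d0.
pose v := tr L.
have mtv : measurable_fun setT v := mtr L.
have iv : (P j).-integrable setT (fun w => (v (X 0%N w))%:E).
  apply: le_integrable ih => //; first by apply/measurable_EFinP; apply: mX0.
  by move=> w _; rewrite !abse_EFin lee_fin norm_tr.
have ihv : (P j).-integrable setT (fun w => (`|h (X 0%N w) - v (X 0%N w)|)%:E).
  apply: le_integrable ih => //.
    apply/measurable_EFinP; apply: measurableT_comp => //.
    by apply: measurable_funB; apply: mX0.
  by move=> w _; rewrite !abse_EFin lee_fin normr_id norm_sub_tr.
pose mv := fine (\int[P j]_w (v (X 0%N w))%:E).
have mvE : (\int[P j]_w (v (X 0%N w))%:E = mv%:E)%E.
  by rewrite fineK//; apply: integrable_fin_num.
have mE : (\int[P j]_w (h (X 0%N w))%:E = m%:E)%E.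
  by rewrite fineK//; apply: integrable_fin_num.
have mvm : mv <= m + eta.
  rewrite -lee_fin EFinD -mvE -mE.
  apply: (@le_trans _ _ (\int[P j]_w (h (X 0%N w))%:E +
     \int[P j]_w (`|h (X 0%N w) - v (X 0%N w)|)%:E)%E); last first.
    apply: leeD2l; apply: le_trans hL _; rewrite lee_fin ge_min lexx//.
  rewrite -integralD//; apply: le_integral => //; first exact: integrableD.
  move=> w _; rewrite -EFinD lee_fin.
  by have := ler_norm (v (X 0%N w) - h (X 0%N w)); rewrite distrC; lra.
(* exponential Chebyshev for the truncated sum, Markov for the remainder *)
pose s := Num.min (2 * L)^-1 (eta / (2 * L ^+ 2)).
have s0 : 0 < s by rewrite lt_min invr_gt0 mulr_gt0// divr_gt0// mulr_gt0// exprn_gt0.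
(* This puts the exponent in the range of [expR_le_quadratic]; the next bound makes the quadratic
   term at most [s * eta]. *)
have sL : s * L <= 2^-1.
  have : s <= (2 * L)^-1 by rewrite ge_min lexx.
  move=> /(ler_wpM2r (ltW L0)) sL; apply: le_trans sL _.
  by have -> : (2 * L)^-1 * L = 2^-1 by field; rewrite gt_eqF.
have sL2 : 2 * (s * L ^+ 2) <= eta.
  have L2 : 0 < 2 * L ^+ 2 by rewrite mulr_gt0// exprn_gt0.
  have : s <= eta / (2 * L ^+ 2) by rewrite ge_min lexx orbT.
  by rewrite ler_pdivlMr//; lra.
pose g x := expR (s * v x).
have g0 x : 0 <= g x by exact: expR_ge0.
have mg : measurable_fun setT g.
  apply: (measurableT_comp (@measurable_expR R)); apply: measurable_funM => //.
have Eg : (\int[P j]_w (g (X 0%N w))%:E <= (expR (s * (m + 2 * eta)))%:E)%E.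
  apply: (@le_trans _ _ (1 + s * mv + 2 * (s * L) ^+ 2)%:E); last first.
    rewrite lee_fin; apply: le_trans (expR_ge1Dx _).
    have h1 : s * mv <= s * (m + eta) by rewrite ler_wpM2l// ltW.
    have h2 : 2 * (s * L) ^+ 2 <= s * eta.
      have -> : 2 * (s * L) ^+ 2 = s * (2 * (s * L ^+ 2)) by ring.
      by rewrite ler_wpM2l// ltW.
    by move: h1 h2; rewrite !mulrDr; lra.
  have icst c : (P j).-integrable setT (fun=> c%:E).
    exact: finite_measure_integrable_cst.
  have isv : (P j).-integrable setT (fun w => (s%:E * (v (X 0%N w))%:E)%E).
    exact: integrableZl.
  apply: (@le_trans _ _ (\int[P j]_w ((1 + 2 * (s * L) ^+ 2)%:E + s%:E * (v (X 0%N w))%:E))%E).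
    apply: ge0_le_integral => //.
    - by move=> w _; rewrite lee_fin.
    - by apply/measurable_EFinP; apply: mX0.
    - apply: emeasurable_funD; first exact: measurable_cst.
      by apply/measurable_EFinP; apply: measurable_funM => //; apply: mX0.
    move=> w _; rewrite -EFinM -EFinD lee_fin.
    have := tr_le L (X 0%N w) (ltW L0); rewrite -/(v _) ler_norml => /andP[v1 v2].
    have sv1 : - (s * L) <= s * v (X 0%N w) by rewrite -mulrN ler_wpM2l// ltW.
    have sv2 : s * v (X 0%N w) <= s * L by rewrite ler_wpM2l// ltW.
    have := expR_le_quadratic (s * v (X 0%N w)) (le_trans sv2 sL).
    have : (s * v (X 0%N w)) ^+ 2 <= (s * L) ^+ 2.
      by rewrite -subr_ge0 subr_sqr mulr_ge0//; lra.
    by rewrite /g; lra.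
  rewrite integralD// integral_cst// integralZl// mvE -EFinM.
  rewrite [X in (_ * X)%E](_ : _ = 1%E); last exact: probability_setT.
  by rewrite mule1 -EFinD lee_fin; lra.
have Egf : (\int[nu]_x (f j x * g x)%:E = \int[P j]_w (g (X 0%N w))%:E)%E.
  by rewrite (iid_integral _ _ _ _ (dens j jK) (iidX j jK)).
pose Y n w := \prod_(k < n) g (X k w).
have EY n : (\int[P j]_w (Y n w)%:E <= (expR (s * (m + 2 * eta)) ^+ n)%:E)%E.
  rewrite (iid_integral_prod _ _ _ _ (dens j jK) (iidX j jK) n (fun=> g))//; last first.
    by move=> k; rewrite Egf; apply: le_lt_trans Eg (ltry _).
  rewrite prodr_const card_ord lee_fin lerXn2r ?nnegrE ?expR_ge0//.
    by rewrite fine_ge0// integral_ge0// => x _; rewrite lee_fin mulr_ge0 ?f0.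
  rewrite Egf -lee_fin fineK// ge0_fin_numE; first exact: le_lt_trans Eg (ltry _).
  by apply: integral_ge0 => w _; rewrite lee_fin.
have mY n : measurable_fun setT (Y n).
  by apply: measurable_prod => k _; exact: measurableT_comp mg (mX k).
have mvX (k : nat) : measurable_fun setT (v \o X k) by exact: measurableT_comp.
have mhX (k : nat) : measurable_fun setT (h \o X k) by exact: measurableT_comp.
have mdX (k : nat) : measurable_fun setT (fun w => `|h (X k w) - v (X k w)|).
  by apply: measurableT_comp => //; apply: measurable_funB; [exact: mhX|exact: mvX].
have mle (c : R) (U : Omega -> R) : measurable_fun setT U -> measurable [set w | c <= U w].
  by move=> mU; rewrite -[X in measurable X]setTI; exact: measurable_fun_le.
pose E1 n := [set w | n%:R * (m + 3 * eta) <= \sum_(k < n) v (X k w)].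
pose E2 n := [set w | n%:R * eta <= \sum_(k < n) `|h (X k w) - v (X k w)|].
have mE1 n : measurable (E1 n) by apply: mle; apply: measurable_sum => k; exact: mvX.
have mE2 n : measurable (E2 n) by apply: mle; apply: measurable_sum => k; exact: mdX.
have P1 n : prob j (E1 n) <= expR (- (s * eta)) ^+ n.
  have -> : expR (- (s * eta)) ^+ n = expR (s * (m + 2 * eta)) ^+ n / expR (s * (n%:R * (m + 3 * eta))).
    rewrite -expRN -!expRM_natl -expRD; congr expR; ring.
  apply: le_trans (prob_markov _ _ _ _ (mY n) _ (expR_gt0 _) (EY n)); last first.
    by move=> w; apply: prodr_ge0.
  apply: prob_le => //; first exact: mle.
  move=> w; rewrite /E1 /= => Hw; rewrite /Y /g -expR_sum ler_expR -mulr_sumr.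
  by rewrite ler_wpM2l// ltW.
have P2 n : (0 < n)%N -> prob j (E2 n) <= eps / 2.
  move=> n0; have n0' : 0 < n%:R :> R by rewrite ltr0n.
  have : (\int[P j]_w (\sum_(k < n) `|h (X k w) - v (X k w)|)%:E <= (n%:R * delta)%:E)%E.
    under eq_integral do rewrite -sumEFin.
    rewrite ge0_integral_sum//; last by move=> k; apply/measurable_EFinP; exact: mdX.
    rewrite mulr_natl -[n in (delta *+ n)]card_ord -sumr_const -sumEFin.
    apply: lee_sum => k _; apply: le_trans hL.
    have mu : measurable_fun setT (fun x => `|h x - v x|).
      by apply: measurableT_comp => //; exact: measurable_funB.
    rewrite !(iid_integral _ _ _ _ (dens j jK) (iidX j jK) _ (fun x => `|h x - v x|))//.
  move=> /(prob_markov _ _ (n%:R * eta)) H.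
  apply: le_trans (H _ _ _) _ => //.
  - exact: measurable_sum.
  - by move=> w; apply: sumr_ge0.
  - by rewrite mulr_gt0.
  rewrite -mulf_div divff ?mul1r ?gt_eqF// ler_pdivrMr// mulrC.
  by rewrite ge_min lexx orbT.
have : (fun n => expR (- (s * eta)) ^+ n) @ \oo --> (0 : R).
  apply: cvg_expr; rewrite ger0_norm ?expR_ge0//.
  by rewrite -[ltRHS](expR0 R) ltr_expR oppr_lt0 mulr_gt0.
move/cvgrPdist_le => /(_ _ e20) [n1 _ hn1]; exists n1.+1 => n n1n.
have n0 : (0 < n)%N by exact: leq_trans n1n.
apply: (@le_trans _ _ (prob j (E1 n) + prob j (E2 n))).
  apply: le_trans (prob_leU _ _ _ (mE1 n) (mE2 n)).
  apply: prob_le; first by apply: mle; apply: measurable_sum => k; exact: mhX.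
    exact: measurableU.
  move=> w /= Hw; have [h1|h1] := leP (n%:R * (m + 3 * eta)) (\sum_(k < n) v (X k w)).
    by left.
  right; rewrite /E2 /=.
  apply: (@le_trans _ _ (\sum_(k < n) (h (X k w) - v (X k w)))).
    rewrite sumrB; move: Hw h1; rewrite aE.
    have -> : n%:R * (m + 4 * eta) = n%:R * (m + 3 * eta) + n%:R * eta by ring.
    by lra.
  by apply: ler_sum => k _; exact: ler_norm.
have := hn1 n (ltnW n1n); rewrite /= sub0r normrN ger0_norm ?exprn_ge0 ?expR_ge0//.
by have := P1 n; have := P2 n n0; lra.
Qed.

End weak_law.

(** * Finite unions, tightness, and thresholds common to finitely many conditions *)

Lemma prob_exists_lt i n (A : nat -> set Omega) : (forall j, measurable (A j)) ->
  measurable [set w | exists2 j, (j < n)%N & A j w] /\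
  prob i [set w | exists2 j, (j < n)%N & A j w] <= \sum_(j < n) prob i (A j).
Proof.
move=> mA; elim: n => [|n [mn IH]].
  rewrite (_ : [set w | _] = set0); last by apply/seteqP; split => w // -[].
  by rewrite big_ord0 /prob measure0.
have -> : [set w | exists2 j, (j < n.+1)%N & A j w] =
    [set w | exists2 j, (j < n)%N & A j w] `|` A n.
  apply/seteqP; split => w.
    move=> [j]; rewrite ltnS leq_eqVlt => /predU1P[->|jn] Aj; first by right.
    by left; exists j.
  by move=> [[j jn Aj]|An]; [exists j => //; exact: ltnW|exists n].
split; first exact: measurableU.
by rewrite big_ord_recr; apply: le_trans (prob_leU _ _ _ mn (mA n)) _; rewrite lerD2r.
Qed.

Lemma tight_fun i (Y : Omega -> R) eps : measurable_fun setT Y -> 0 < eps ->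
  exists C, forall B, C < B -> prob i [set w | B <= Y w] <= eps.
Proof.
move=> mY e0.
have mB B : measurable [set w | B <= Y w].
  by rewrite -[X in measurable X]setTI; exact: measurable_fun_le.
pose F (n : nat) := [set w | n%:R <= Y w].
have cap0 : \bigcap_n F n = set0.
  apply/seteqP; split => // w /(_ (Num.truncn `|Y w|).+1 I) /=.
  by move=> /(lt_le_trans (truncnS_gt _)) /(le_lt_trans (ler_norm _)); rewrite ltxx.
have cv : (P i \o F) n @[n --> \oo] --> P i (\bigcap_n F n).
  apply: nonincreasing_cvg_mu.
  - by apply: le_lt_trans (probability_le1 _ (mB _)) (ltry _).
  - by move=> n; exact: mB.
  - by apply: bigcapT_measurable => n; exact: mB.
  - move=> m n mn; apply/subsetPset => w /=; apply: le_trans.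
    by rewrite ler_nat.
rewrite cap0 measure0 in cv.
have /fine_cvgP[_ /cvgrPdist_le /(_ eps e0) [n _ hn]] := cv.
exists n%:R => B nB; apply: le_trans (_ : prob i (F n) <= eps).
  by apply: prob_le; [exact: mB|exact: mB|move=> w /=; apply: le_trans; exact: ltW].
by have := hn n (leqnn n); rewrite /= sub0r normrN; apply: le_trans; exact: ler_norm.
Qed.

(** Disposes of the finitely many times before an asymptotic statement takes effect: for large [B]
    the level is then rarely reached. *)
Lemma tight_early i (U : nat -> Omega -> R) m eps : (forall t, measurable_fun setT (U t)) ->
  0 < eps -> exists C, forall B, C < B ->
    measurable [set w | exists2 t, (t < m)%N & B <= U t w] /\
    prob i [set w | exists2 t, (t < m)%N & B <= U t w] <= eps.
Proof.
move=> mU; elim: m eps => [|m IH] eps e0.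
  exists 0 => B _; have [] := prob_exists_lt i 0 (fun t => [set w | B <= U t w]).
    by move=> t; rewrite -[X in measurable X]setTI; exact: measurable_fun_le.
  by rewrite big_ord0 => mB /le_trans h; split => //; apply: h; exact: ltW.
have e20 : 0 < eps / 2 by rewrite divr_gt0.
have [C1 h1] := IH _ e20.
have [C2 h2] := tight_fun i _ _ (mU m) e20.
exists (Num.max C1 C2) => B; rewrite gt_max => /andP[B1 B2].
have [mA hA] := h1 B B1; have hB := h2 B B2.
have mB : measurable [set w | B <= U m w].
  by rewrite -[X in measurable X]setTI; exact: measurable_fun_le.
have -> : [set w | exists2 t, (t < m.+1)%N & B <= U t w] =
    [set w | exists2 t, (t < m)%N & B <= U t w] `|` [set w | B <= U m w].
  apply/seteqP; split => w.
    move=> [j]; rewrite ltnS leq_eqVlt => /predU1P[->|jn] Aj; first by right.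
    by left; exists j.
  by move=> [[j jn Aj]|An]; [exists j => //; exact: ltnW|exists m].
split; first exact: measurableU.
apply: le_trans (prob_leU _ _ _ mA mB) _; lra.
Qed.

Lemma eventually_forall_nat n (Q : nat -> nat -> Prop) :
  (forall j, (j < n)%N -> exists m0, forall m, (m0 <= m)%N -> Q j m) ->
  exists m0, forall m, (m0 <= m)%N -> forall j, (j < n)%N -> Q j m.
Proof.
elim: n => [|n IH] H; first by exists 0%N.
have [m1 h1] := IH (fun j jn => H j (ltnW jn)).
have [m2 h2] := H n (ltnSn n).
exists (maxn m1 m2) => m; rewrite geq_max => /andP[mm1 mm2] j.
by rewrite ltnS leq_eqVlt => /predU1P[->|jn]; [exact: h2|exact: h1].
Qed.

Lemma eventually_forall_real n (Q : nat -> R -> Prop) :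
  (forall j, (j < n)%N -> exists C, forall B, C < B -> Q j B) ->
  exists C, forall B, C < B -> forall j, (j < n)%N -> Q j B.
Proof.
elim: n => [|n IH] H; first by exists 0.
have [C1 h1] := IH (fun j jn => H j (ltnW jn)).
have [C2 h2] := H n (ltnSn n).
exists (Num.max C1 C2) => B; rewrite gt_max => /andP[B1 B2] j.
by rewrite ltnS leq_eqVlt => /predU1P[->|jn]; [exact: h2|exact: h1].
Qed.

Hypothesis Deq : forall i j x, (i <= K)%N -> (j <= K)%N ->
  nu [set x | f i x != f j x] = 0%E -> D x -> f i x = f j x.

Lemma LR_eq i j t w : (i <= K)%N -> (j <= K)%N -> nu [set x | f i x != f j x] = 0%E ->
  ok_upto t w -> LR f X i t w = LR f X j t w.
Proof.
move=> iK jK ij okw; apply: eq_bigr => k _.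
by rewrite (Deq i j)//; apply: okw.
Qed.

Lemma LLR_past i s t : (i <= K)%N -> (s <= t)%N -> past_fun t (LLR f X i s).
Proof.
move=> iK st; apply: (past_fun_comp _ _ _ (@measurable_ln R)); exact: LR_past.
Qed.

Lemma crossing_prob_limit i (mu : probability R R) kap e : (1 <= i <= K)%N -> 0 < kap ->
  is_limit_overshoot (P i) (upper_overshoot_le (LLR f X i)) mu -> 0 < e ->
  exists C, forall B, C < B ->
    `|B / kap * prob 0 [set w | exists t, ln (B / kap) <= LLR f X i t w] -
      overshoot_const mu| <= e.
Proof.
move=> /andP[i1 iK] k0 lim e0.
have [|C hC] := overshoot_limit i 0 (LLR f X i) iK (leq0n K)
  (fun t => LLR_past i t t iK (leqnn t)) _ mu lim e e0.
  by move=> t w okw; rewrite LR_0// mulr1 lnK// posrE LR_gt0.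
exists (kap * expR C) => B CB.
have B0 : 0 < B by apply: le_lt_trans CB; rewrite mulr_ge0 ?expR_ge0// ltW.
have Bk : 0 < B / kap by rewrite divr_gt0.
rewrite -[X in `|X * _ - _|](lnK Bk); apply: hC.
by rewrite -ltr_expR lnK// ltr_pdivlMr// mulrC.
Qed.

(** * The mixture and its dominating component *)

Section mixture.
Variable q : nat -> R.
Hypothesis q0 : forall i, (1 <= i <= K)%N -> 0 < q i.

Let q0' (l : 'I_K) : 0 < q l.+1. Proof. by apply: q0; exact: (ltn_ord l). Qed.

(* Total weight of the hypotheses whose density equals [f i] nu-a.e.: the limit of
   [mixLR q / LR i] under [P i]. *)
Definition class_weight (i : nat) : R :=
  \sum_(1 <= j < K.+1) q j * (nu [set x | f j x != f i x] == 0%E)%:R.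

(** The class of [i] fails to account for the mixture up to a factor [1 + e]; at late times this is
    exceptional under [P_i]. *)
Definition undominated i (e : R) (t : nat) : set Omega :=
  [set w | (1 + e) * (class_weight i * LR f X i t w) < mixLR K f X q t w].

Lemma class_weight_ge i : (1 <= i <= K)%N -> q i <= class_weight i.
Proof.
case: i => // i /= iK; rewrite /class_weight big_nat1_ord (bigD1 (Ordinal iK))//=.
have -> : [set x | f i.+1 x != f i.+1 x] = set0.
  by apply/seteqP; split => x //=; rewrite eqxx.
rewrite measure0 eqxx mulr1 lerDl; apply: sumr_ge0 => l _.
by rewrite mulr_ge0// ltW.
Qed.

Lemma class_weight_gt0 i : (1 <= i <= K)%N -> 0 < class_weight i.
Proof. by move=> iK; apply: lt_le_trans (class_weight_ge i iK); exact: q0. Qed.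

Let class_weight_LR i t w : (1 <= i <= K)%N -> ok_upto t w ->
  class_weight i * LR f X i t w = \sum_(l < K)
    q l.+1 * (nu [set x | f l.+1 x != f i x] == 0%E)%:R * LR f X l.+1 t w.
Proof.
move=> /andP[i1 iK] okw; rewrite /class_weight big_nat1_ord mulr_suml.
apply: eq_bigr => l _; case: eqP => [li|_]; last by rewrite mulr0 !mul0r.
by rewrite (LR_eq l.+1 i).
Qed.

Lemma class_weight_mixLR i t w : (1 <= i <= K)%N -> ok_upto t w ->
  class_weight i * LR f X i t w <= mixLR K f X q t w.
Proof.
move=> iK okw; rewrite class_weight_LR// /mixLR big_nat1_ord; apply: ler_sum => l _.
rewrite ler_wpM2r ?LR_ge0//; case: eqP => _; first by rewrite mulr1.
by rewrite mulr0 ltW.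
Qed.

Lemma undominated_past i e t : (i <= K)%N -> past t (undominated i e t).
Proof.
move=> iK; apply: past_fun_lt; last exact: mixLR_past.
apply: past_funM; first exact: past_fun_cst.
by apply: past_funM; [exact: past_fun_cst|exact: LR_past].
Qed.

Lemma undominated_vanish i e eps : (1 <= i <= K)%N -> 0 < e -> 0 < eps ->
  exists m0, forall m, (m0 <= m)%N ->
    prob i (\bigcup_(t in [set t | (m <= t)%N]) undominated i e t) <= eps.
Proof.
move=> iK e0 eps0; have iK' : (i <= K)%N by case/andP: iK.
have K0 : (0 < K)%N by case/andP: iK => i1; exact: leq_trans.
have K0' : 0 < K%:R :> R by rewrite ltr0n.
(* Each density outside the class of [i] is allowed the share [e * class_weight i / K] of the
   excess; dividing by its weight gives the tolerance for its ratio to [LR_i]. *)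
pose dl l := e * class_weight i / (K%:R * q l.+1).
have dl0 l : (l < K)%N -> 0 < dl l.
  by move=> lK; rewrite divr_gt0 ?mulr_gt0// ?class_weight_gt0// q0.
pose A l m := [set w | exists t, (m <= t)%N /\ dl l * LR f X i t w < LR f X l.+1 t w].
have mA l m : (l < K)%N -> measurable (A l m).
  move=> lK; rewrite (_ : A l m = \bigcup_(t in [set t | (m <= t)%N])
     [set w | dl l * LR f X i t w < LR f X l.+1 t w]); last first.
    by apply/seteqP; split => w; [move=> [t [mt h]]; exists t|move=> [t mt h]; exists t].
  apply: bigcup_measurable => t _; apply: (past_measurable t); apply: past_fun_lt.
    by apply: past_funM; [exact: past_fun_cst|exact: LR_past].
  exact: LR_past.
pose B l m := if (l < K)%N && (nu [set x | f l.+1 x != f i x] != 0%E) then A l m else set0.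
have mB l m : measurable (B l m).
  by rewrite /B; case: ifP => // /andP[lK _]; exact: mA.
have [m0 hm0] : exists m0, forall m, (m0 <= m)%N -> forall l, (l < K)%N ->
    prob i (B l m) <= eps / K%:R.
  apply: eventually_forall_nat => l lK.
  have eK : 0 < eps / K%:R by rewrite divr_gt0.
  have [nu0|ne] := eqVneq (nu [set x | f l.+1 x != f i x]) 0%E.
    by exists 0%N => m _; rewrite /B nu0 eqxx andbF /prob measure0; exact: ltW.
  have [m1 h1] := likelihood_ratio_vanish i l.+1 iK' lK ne _ _ (dl0 l lK) eK.
  by exists m1 => m mm1; rewrite /B lK ne; exact: h1.
exists m0 => m m0m.
have [mU hU] := prob_exists_lt i K (fun l => B l m) (fun l => mB l m).
apply: (@le_trans _ _ (\sum_(l < K) prob i (B l m))); last first.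
  apply: (@le_trans _ _ (\sum_(l < K) (eps / K%:R))).
    by apply: ler_sum => l _; exact: hm0.
  by rewrite sumr_const card_ord -[leLHS]mulr_natr divfK// gt_eqF.
apply: le_trans hU; apply: prob_mono_ok => //.
  apply: bigcup_measurable => t _; exact: (past_measurable _ _ (undominated_past i e t iK')).
move=> w [[t /= mt badw] okw].
have okt : ok_upto t w by move=> k _; exact: okw.
apply: contrapT => nB.
have small (l : 'I_K) : nu [set x | f l.+1 x != f i x] != 0%E ->
    q l.+1 * LR f X l.+1 t w <= e * class_weight i / K%:R * LR f X i t w.
  move=> ne; rewrite leNgt; apply/negP => lt; apply: nB; exists l => //.
  rewrite /B ltn_ord ne /=; exists t; split => //.
  rewrite /dl -(ltr_pM2l (q0' l)); apply: le_lt_trans lt.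
  have ql : q l.+1 != 0 by rewrite gt_eqF.
  have Kn : K%:R != 0 :> R by rewrite gt_eqF.
  rewrite le_eqVlt; apply/orP; left; apply/eqP; field.
  by rewrite ql Kn.
move: badw; rewrite /undominated /= ltNge => /negP; apply.
rewrite /mixLR big_nat1_ord mulrDl mul1r [X in _ <= X + _]class_weight_LR//.
apply: (@le_trans _ _ (\sum_(l < K) (q l.+1 * (nu [set x | f l.+1 x != f i x] == 0%E)%:R *
   LR f X l.+1 t w + e * class_weight i / K%:R * LR f X i t w))).
  apply: ler_sum => l _; have [e0'|ne] := eqVneq (nu [set x | f l.+1 x != f i x]) 0%E.
    rewrite mulr1 lerDl mulr_ge0 ?LR_ge0// divr_ge0// mulr_ge0// ltW//.
    exact: class_weight_gt0.
  by rewrite mulr0 mul0r add0r small.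
rewrite big_split/= lerD2l sumr_const card_ord -[leLHS]mulr_natr.
rewrite le_eqVlt; apply/orP; left; apply/eqP; field.
by rewrite gt_eqF.
Qed.

(** Late times are covered by [undominated_vanish]; at early times the mixture rarely reaches [B].
    The threshold [C] is chosen before [G], because the families to which this is applied themselves
    depend on [A] and [B]. *)
Lemma undominated_crossing i e eps : (1 <= i <= K)%N -> 0 < e -> 0 < eps ->
  exists C, forall B, C < B -> forall G, (forall t, past t (G t)) ->
    (forall t w, G t w -> B <= mixLR K f X q t w) ->
    prob i (\bigcup_t (G t `&` undominated i e t)) <= eps.
Proof.
move=> iK e0 eps0; have iK' : (i <= K)%N by case/andP: iK.
have e20 : 0 < eps / 2 by rewrite divr_gt0.
have [m hm] := undominated_vanish i e _ iK e0 e20.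
have mU t : measurable_fun setT (mixLR K f X q t).
  exact: (past_fun_measurable _ _ (mixLR_past q t)).
have [C hC] := tight_early i _ m _ mU e20.
exists C => B CB G pG GB; have [mE hE] := hC B CB.
have mbad : measurable (\bigcup_(t in [set t | (m <= t)%N]) undominated i e t).
  by apply: bigcup_measurable => t _; exact: (past_measurable _ _ (undominated_past i e t iK')).
apply: (@le_trans _ _ (eps / 2 + eps / 2)); last by rewrite -splitr.
apply: le_trans (lerD hE (hm m (leqnn m))).
apply: le_trans (prob_leU _ _ _ mE mbad); apply: prob_le.
- apply: bigcupT_measurable => t; apply: (past_measurable t); apply: pastI => //.
  exact: undominated_past.
- exact: measurableU.
move=> w [t _ [Gt bt]]; have [tm|mt] := ltnP t m; first by left; exists t => //; exact: GB.
by right; exists t.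
Qed.

Lemma undominatedN i e t w : ~ undominated i e t w <->
  mixLR K f X q t w <= (1 + e) * (class_weight i * LR f X i t w).
Proof. by rewrite /undominated /= leNgt; split => /negP. Qed.

Section accepted_families.
Variables (G : nat -> set Omega) (B e : R).
Hypotheses (aG : adapted G) (B0 : 0 < B) (e0 : 0 < e).
Hypothesis GB : forall t w, G t w -> B <= mixLR K f X q t w.

Let dominatedF i t := G t `&` ~` undominated i e t.
Let undominatedF i t := G t `&` undominated i e t.

Let dominatedF_adapted (l : 'I_K) : adapted (dominatedF l.+1).
Proof. by apply: adaptedI => // t; apply: pastC; exact: undominated_past. Qed.

Let undominatedF_adapted (l : 'I_K) : adapted (undominatedF l.+1).
Proof. by apply: adaptedI => // t; exact: undominated_past. Qed.

(** With [M] the mixture, [B] is the sum of the shares [B / M * q_l LR_l]. Always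
    [LR_l / M <= 1 / kappa_l], which serves on the dominated part; on the undominated part [B <= M]
    leaves [q_l LR_l], that is, a probability under hypothesis [l]. *)
Lemma mixture_upper : B * prob 0 (\bigcup_t G t) <=
  \sum_(l < K) q l.+1 / class_weight l.+1 * (B * prob 0 (\bigcup_t dominatedF l.+1 t)) +
  \sum_(l < K) q l.+1 * prob l.+1 (\bigcup_t undominatedF l.+1 t).
Proof.
have := comparison (Wfam (- B) 0 (leq0n K) G aG ::
  [seq Wfam (q l.+1 / class_weight l.+1 * B) 0 (leq0n K) _ (dominatedF_adapted l) | l : 'I_K] ++
  [seq Wfam (q l.+1) l.+1 (ltn_ord l) _ (undominatedF_adapted l) | l : 'I_K]).
rewrite big_cons big_cat/= big_map big_enum/= big_map big_enum/= mulNr [X in 0 <= X]addrC subr_ge0 => H.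
under eq_bigr do rewrite mulrA; apply: H => t w okw.
rewrite big_cons big_cat/= big_map big_enum/= big_map big_enum/= mulNr [X in 0 <= X]addrC subr_ge0 !LR_0// !mul1r.
have [Gw|nGw] := pselect (G t w); last first.
  rewrite indicE memNset// mulr0 addr_ge0//; apply: sumr_ge0 => l _.
    rewrite indicE memNset ?mulr0//; by move=> [].
  rewrite indicE memNset ?mulr0//; by move=> [].
rewrite indicE mem_set// mulr1 -big_split/=.
have M0 : 0 < mixLR K f X q t w by exact: lt_le_trans B0 (GB _ _ Gw).
apply: (@le_trans _ _ (\sum_(l < K) B / mixLR K f X q t w * (q l.+1 * LR f X l.+1 t w))).
  rewrite -mulr_sumr -(big_nat1_ord (fun i => q i * LR f X i t w)) -/(mixLR K f X q t w).
  by rewrite divfK ?gt_eqF.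
apply: ler_sum => l _.
have lK : (1 <= l.+1 <= K)%N by exact: ltn_ord.
have kl := class_weight_gt0 _ lK.
have [bad|good] := pselect (undominated l.+1 e t w).
  have -> : \1_(dominatedF l.+1 t) w = 0 :> R by rewrite indicE memNset// => -[_]; exact.
  have -> : \1_(undominatedF l.+1 t) w = 1 :> R by rewrite indicE mem_set.
  rewrite !mulr0 add0r mulr1 -[leRHS]mul1r; apply: ler_wpM2r.
    by rewrite mulr_ge0 ?LR_ge0 ?ltn_ord// ltW.
  by rewrite ler_pdivrMr// mul1r; exact: GB.
have -> : \1_(dominatedF l.+1 t) w = 1 :> R by rewrite indicE mem_set.
have -> : \1_(undominatedF l.+1 t) w = 0 :> R by rewrite indicE memNset// => -[_] /good.
rewrite !mulr0 addr0 !mulr1.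
have := class_weight_mixLR _ _ _ lK okw.
rewrite mulrC -ler_pdivlMr// => h.
rewrite [leLHS](_ : _ = q l.+1 * (B / mixLR K f X q t w) * LR f X l.+1 t w); last by ring.
rewrite [leRHS](_ : _ = q l.+1 * (B / mixLR K f X q t w) * (mixLR K f X q t w / class_weight l.+1)).
  by rewrite ler_wpM2l// mulr_ge0 ?divr_ge0// ltW.
by field; rewrite !gt_eqF.
Qed.

(** Where the mixture [M] is at most [(1 + e) kappa_l LR_l], the quotient [q_l / kappa_l] is at most
    [(1 + e) q_l LR_l / M], and these quantities sum over [l] to [1 + e]. *)
Lemma mixture_lower :
  \sum_(l < K) q l.+1 / class_weight l.+1 * prob 0 (\bigcup_t dominatedF l.+1 t) <=
  (1 + e) * prob 0 (\bigcup_t G t).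
Proof.
have := comparison (Wfam (1 + e) 0 (leq0n K) G aG ::
  [seq Wfam (- (q l.+1 / class_weight l.+1)) 0 (leq0n K) _ (dominatedF_adapted l) | l : 'I_K]).
rewrite big_cons big_map big_enum/=.
under [X in _ -> 0 <= _ + X]eq_bigr do rewrite mulNr.
rewrite sumrN subr_ge0; apply => t w okw.
rewrite big_cons big_map big_enum/= !LR_0// !mul1r.
under eq_bigr do rewrite mul1r mulNr.
rewrite sumrN subr_ge0.
have [Gw|nGw] := pselect (G t w); last first.
  rewrite indicE memNset// mulr0; apply: sumr_le0 => l _.
  rewrite indicE memNset ?mulr0//; by move=> [].
rewrite indicE mem_set// mulr1.
have M0 : 0 < mixLR K f X q t w by exact: lt_le_trans B0 (GB _ _ Gw).
apply: (@le_trans _ _ (\sum_(l < K) (1 + e) / mixLR K f X q t w * (q l.+1 * LR f X l.+1 t w))); last first.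
  rewrite -mulr_sumr -(big_nat1_ord (fun i => q i * LR f X i t w)) -/(mixLR K f X q t w).
  by rewrite divfK ?gt_eqF.
apply: ler_sum => l _.
have lK : (1 <= l.+1 <= K)%N by exact: ltn_ord.
have kl := class_weight_gt0 _ lK.
have [bad|good] := pselect (undominated l.+1 e t w).
  have -> : \1_(dominatedF l.+1 t) w = 0 :> R by rewrite indicE memNset// => -[_]; exact.
  rewrite mulr0; apply: mulr_ge0; first by rewrite divr_ge0 ?(ltW M0)// addr_ge0// ltW.
  by rewrite mulr_ge0 ?LR_ge0 ?ltn_ord// ltW.
have -> : \1_(dominatedF l.+1 t) w = 1 :> R by rewrite indicE mem_set.
rewrite mulr1.
move/undominatedN : good => h.
rewrite [leLHS](_ : _ = q l.+1 / class_weight l.+1 / mixLR K f X q t w * mixLR K f X q t w); last first.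
  by rewrite divfK ?gt_eqF.
apply: (@le_trans _ _ (q l.+1 / class_weight l.+1 / mixLR K f X q t w *
   ((1 + e) * (class_weight l.+1 * LR f X l.+1 t w)))).
  by rewrite ler_wpM2l// !divr_ge0// ltW.
rewrite le_eqVlt; apply/orP; left; apply/eqP; field.
by rewrite !gt_eqF.
Qed.

End accepted_families.

End mixture.

Lemma past_exists_le t (A : nat -> set Omega) : (forall s, past s (A s)) ->
  past t [set w | exists2 s, (s <= t)%N & A s w].
Proof.
move=> pA; rewrite (_ : [set w | _] = \bigcup_s (if (s <= t)%N then A s else set0)).
  apply: past_bigcup => s; case: ifP => [st|_]; last exact: past0.
  exact: past_mono st (pA s).
apply/seteqP; split => w; first by move=> [s st As]; exists s => //; rewrite st.
by move=> [s _]; case: ifP => // st As; exists s.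
Qed.

Lemma stopped_before U L A B t w : stop_set U L A B t w ->
  exists2 s, (s <= t)%N & seqDU (stop_set U L A B) s w.
Proof.
move=> St.
have ex : exists s, `[<stop_set U L A B s w>] by exists t; apply/asboolP.
case: (ex_minnP ex) => s /asboolP Ss smin.
exists s; first by apply: smin; apply/asboolP.
rewrite /seqDU -bigcup_mkord; split => // -[k /= ks Sk].
by have := smin k (asboolT Sk); rewrite leqNgt ks.
Qed.

(** * False alarm probabilities *)

Section false_alarm_asymptotics.
Variables (H : nat -> probability R R) (q0 q1 : nat -> R).
Hypotheses (q0P : forall i, (1 <= i <= K)%N -> 0 < q0 i)
  (q1P : forall i, (1 <= i <= K)%N -> 0 < q1 i) (K0 : (1 <= K)%N).
Hypothesis limH : forall i, (1 <= i <= K)%N ->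
  is_limit_overshoot (P i) (upper_overshoot_le (LLR f X i)) (H i).

Let S := \sum_(1 <= j < K.+1) q1 j * overshoot_const (H j).
Let Q := \sum_(l < K) q1 l.+1.
Let gam l := overshoot_const (H l.+1).
Let kap l := class_weight q1 l.+1.
Let lK (l : nat) : (l < K)%N -> (1 <= l.+1 <= K)%N. Proof. by []. Qed.

Let SE : S = \sum_(l < K) q1 l.+1 * gam l.
Proof. by rewrite /S big_nat1_ord. Qed.

Let gam_gt0 l : (l < K)%N -> 0 < gam l.
Proof. by move=> lt; apply: overshoot_const_gt0; case: (limH l.+1 (lK l lt)). Qed.

Let S_gt0 : 0 < S.
Proof.
rewrite SE (bigD1 (Ordinal K0))//= ltr_pwDl ?mulr_gt0 ?q1P ?gam_gt0//.
by apply: sumr_ge0 => l _; rewrite mulr_ge0// ltW ?q1P ?gam_gt0//; exact: lK.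
Qed.

Let Q_ge0 : 0 <= Q.
Proof. by apply: sumr_ge0 => l _; rewrite ltW// q1P//; exact: lK. Qed.

Let kap_gt0 l : (l < K)%N -> 0 < kap l.
Proof. by move=> lt; apply: class_weight_gt0 => //; exact: lK. Qed.

Let hit i c := [set w | exists t, c <= LLR f X i t w].

Let hit_measurable i c : (i <= K)%N -> measurable (hit i c).
Proof.
move=> iK; rewrite /hit -bigcup_crossing; apply: adapted_measurable.
by apply: crossing_adapted => t; exact: LLR_past.
Qed.

Let le_hit i (x : R) t w : (i <= K)%N -> ok_upto t w -> 0 < x -> x <= LR f X i t w ->
  ln x <= LLR f X i t w.
Proof. by move=> iK okw x0 xL; rewrite /LLR ler_ln ?posrE ?LR_gt0. Qed.

(** The total error is at most [e * S] from factors [1 + e], plus three errors of size [e] in each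
    summand, weighted by [q1]. *)
Let small_e eps : 0 < eps ->
  exists e, [/\ 0 < e, e <= 1 & e * (S + 3 * Q) <= eps * S].
Proof.
move=> eps0; have SQ : 0 < S + 3 * Q by rewrite ltr_pwDl// mulr_ge0.
exists (Num.min 1 (eps * S / (S + 3 * Q))); split.
- by rewrite lt_min ltr01 divr_gt0// mulr_gt0.
- by rewrite ge_min lexx.
- by rewrite -ler_pdivlMr// ge_min lexx orbT.
Qed.

(** The maximum reaches [B] only if some [LR_l] reaches [B / q1 l]; the union bound then leaves the
    single crossing limits. *)
Lemma maxLR_false_alarm eps : 0 < eps -> exists C, forall A B, C < A -> C < B ->
  prob 0 (accept1 (maxLR K f X q1) (maxLR K f X q0) A B) <= S / B * (1 + eps).
Proof.
move=> eps0; have [e [e0 e1 eS]] := small_e _ eps0.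
have [C hC] : exists C, forall B, C < B -> forall l, (l < K)%N ->
    `|B / q1 l.+1 * prob 0 (hit l.+1 (ln (B / q1 l.+1))) - gam l| <= e.
  apply: eventually_forall_real => l lt.
  exact: crossing_prob_limit (lK _ lt) (q1P _ (lK _ lt)) (limH _ (lK _ lt)) e0.
exists (Num.max C 0) => A B _; rewrite gt_max => /andP[/hC{}hC B0].
have aG := accepted1_adapted _ _ A B (maxLR_past q1) (maxLR_past q0).
have mh l : measurable (if (l < K)%N then hit l.+1 (ln (B / q1 l.+1)) else set0).
  by case: ifP => // lt; exact: hit_measurable.
have [mU hU] := prob_exists_lt 0 K _ mh.
rewrite mulrAC ler_pdivlMr// mulrC.
apply: (@le_trans _ _ (B * \sum_(l < K) prob 0 (hit l.+1 (ln (B / q1 l.+1))))).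
  rewrite ler_wpM2l ?(ltW B0)// accept1E.
  apply: (@le_trans _ _ (prob 0 [set w | exists2 j, (j < K)%N &
      (if (j < K)%N then hit j.+1 (ln (B / q1 j.+1)) else set0) w])); last first.
    by apply: le_trans hU _; apply: ler_sum => l _; rewrite ltn_ord.
  apply: prob_mono_ok => //; first exact: adapted_measurable.
  move=> w [[t _ [_ /= BU]] okw].
  have okt : ok_upto t w by move=> k _; exact: okw.
  apply: contrapT => nh; move: BU; rewrite leNgt => /negP; apply.
  rewrite /maxLR big_seq; apply: bigmax_lt => // -[|l]; rewrite mem_index_iota// => /andP[_].
  rewrite ltnS => lt.
  rewrite ltNge; apply/negP => BU; apply: nh; exists l => //; rewrite lt.
  have ql := q1P _ (lK _ lt).
  exists t; apply: le_hit => //; first by rewrite divr_gt0.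
  by rewrite ler_pdivrMr// mulrC.
rewrite mulr_sumr; apply: (@le_trans _ _ (\sum_(l < K) (q1 l.+1 * gam l + q1 l.+1 * e))).
  apply: ler_sum => l _; have ql := q1P _ (lK _ (ltn_ord l)).
  have := hC l (ltn_ord l); rewrite ler_norml => /andP[_ h].
  rewrite -mulrDr -ler_pdivrMl// mulrA [_^-1 * _]mulrC.
  by move: h; lra.
rewrite big_split/= -SE -mulr_suml -/Q mulrDr mulr1 lerD2l.
have : e * Q <= e * (3 * Q) by rewrite ler_wpM2l ?(ltW e0)//; move: Q_ge0; lra.
have : 0 <= e * S by rewrite mulr_ge0 ?ltW.
by move: eS; rewrite mulrDr; lra.
Qed.

(** When [LR_l] crosses [B / kappa_l] the mixture is at least [B], so the test has stopped by then:
    it accepted [H_0], or accepted [H_1] undominated, or accepted [H_1] dominated. In the first two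
    cases passing to hypothesis [l] at the crossing time gains the factor [kappa_l / B], and what
    remains is at most [e], by the bound on missed detection and by [bad]. *)
Let crossing_decomposition A B e l : (l < K)%N -> 0 < A -> kap l < B -> 0 < e ->
  (A * q0 l.+1)^-1 <= e ->
  (forall G, (forall t, past t (G t)) ->
    (forall t w, G t w -> B <= mixLR K f X q1 t w) ->
    prob l.+1 (\bigcup_t (G t `&` undominated q1 l.+1 e t)) <= e) ->
  forall G, G = accepted1 (mixLR K f X q1) (mixLR K f X q0) A B ->
  B / kap l * prob 0 (hit l.+1 (ln (B / kap l))) <=
  B / kap l * prob 0 (\bigcup_t (G t `&` ~` undominated q1 l.+1 e t)) + 2 * e.
Proof.
move=> lt A0 kB e0 Ae bad G GE.
have kl := kap_gt0 _ lt.
have B0 : 0 < B by exact: lt_trans kB.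
have Bk : 0 < B / kap l by rewrite divr_gt0.
have aG : adapted G by rewrite GE; exact: accepted1_adapted _ _ A B (mixLR_past q1) (mixLR_past q0).
have aG0 := accepted0_adapted _ _ A B (mixLR_past q1) (mixLR_past q0).
pose G0 := accepted0 (mixLR K f X q1) (mixLR K f X q0) A B.
pose Gu t := G t `&` undominated q1 l.+1 e t.
have pGu t : past t (Gu t) by apply: pastI; [case: aG|exact: undominated_past].
have aGu : adapted Gu by apply: adaptedI => // t; exact: undominated_past.
pose cr := crossing (LLR f X l.+1) (ln (B / kap l)).
have acr : adapted cr by apply: crossing_adapted => t; exact: LLR_past.
(* Indexed by the crossing time [t], not by the earlier stopping time [s], because [LR_l] is known
   to be large at [t] only. *)
pose F1 t := cr t `&` [set w | exists2 s, (s <= t)%N & G0 s w].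
pose F2 t := cr t `&` [set w | exists2 s, (s <= t)%N & Gu s w].
have aF1 : adapted F1.
  by apply: adaptedI => // t; apply: past_exists_le; case: aG0.
have aF2 : adapted F2 by apply: adaptedI => // t; exact: past_exists_le.
have adom : adapted (fun t => G t `&` ~` undominated q1 l.+1 e t).
  by apply: adaptedI => // t; apply: pastC; exact: undominated_past.
have crLR t w : ok_upto t w -> cr t w -> B / kap l <= LR f X l.+1 t w.
  move=> okw /crossingP[+ _]; rewrite /LLR ler_ln ?posrE ?LR_gt0//.
have small F Y : adapted F -> (forall t, F t `<=` cr t) -> measurable Y ->
    \bigcup_t F t `<=` Y -> B / kap l * prob 0 (\bigcup_t F t) <= prob l.+1 Y.
  move=> aF Fcr mY FY.
  apply: (@le_trans _ _ (1 * prob l.+1 (\bigcup_t F t))).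
    apply: compare_prob => // t w okw /Fcr crw.
    by rewrite LR_0// mulr1 mul1r crLR.
  by rewrite mul1r; apply: prob_le => //; exact: adapted_measurable.
have s1 : B / kap l * prob 0 (\bigcup_t F1 t) <= e.
  apply: (@le_trans _ _ (prob l.+1 (\bigcup_t G0 t))).
    apply: small => //; [by move=> t w []|exact: adapted_measurable|].
    by move=> w [t _ [_ [s _ Gs]]]; exists s.
  apply: le_trans Ae; rewrite -accept0E; apply: missed_detection_le => //.
  - exact: mixLR_past.
  - exact: mixLR_past.
  - exact: q0P (lK _ lt).
  - by move=> t w; apply: le_mixLR => //; exact: lK.
have s2 : B / kap l * prob 0 (\bigcup_t F2 t) <= e.
  apply: (@le_trans _ _ (prob l.+1 (\bigcup_t Gu t))).
    apply: small => //; [by move=> t w []|exact: adapted_measurable|].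
    by move=> w [t _ [_ [s _ Gs]]]; exists s.
  by apply: bad => [t|t w]; [case: aG|rewrite GE => -[]].
have mD' := adapted_measurable _ adom.
have mF1 := adapted_measurable _ aF1.
have mF2 := adapted_measurable _ aF2.
have : prob 0 (hit l.+1 (ln (B / kap l))) <=
    prob 0 (\bigcup_t (G t `&` ~` undominated q1 l.+1 e t)) +
    prob 0 (\bigcup_t F1 t) + prob 0 (\bigcup_t F2 t).
  apply: le_trans (_ : _ <= _ ) (lerD (prob_leU _ _ _ mD' mF1) (lexx _)).
  apply: le_trans (prob_leU _ _ _ (measurableU _ _ mD' mF1) mF2).
  apply: prob_mono_ok => //; first exact: hit_measurable.
    by apply: measurableU => //; exact: measurableU.
  move=> w [+ okw]; rewrite /hit -bigcup_crossing => -[t _ crt].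
  have okt s : ok_upto s w by move=> k _; exact: okw.
  have Bmix : B <= mixLR K f X q1 t w.
    apply: le_trans (class_weight_mixLR _ q1P _ _ _ (lK _ lt) (okt t)).
    by have := crLR t w (okt t) crt; rewrite ler_pdivrMr// mulrC.
  (* At time 0 the ratio is the empty product 1, below [B / kap l]. *)
  have t1 : (1 <= t)%N.
    case: t crt {Bmix} => // /(crLR 0%N w (okt 0%N)).
    by rewrite /LR big_ord0 ler_pdivrMr// mul1r leNgt kB.
  have [s st Ss] := stopped_before _ _ _ _ t w (conj t1 (or_introl Bmix)
    : stop_set (mixLR K f X q1) (mixLR K f X q0) A B t w).
  have [BU|UB] := leP B (mixLR K f X q1 s w); last first.
    by left; right; exists t => //; split => //; exists s.
  have [u|nu'] := pselect (undominated q1 l.+1 e s w).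
    by right; exists t => //; split => //; exists s => //; rewrite /Gu GE.
  by left; left; exists s => //; rewrite GE.
move=> /(ler_wpM2l (ltW Bk)); rewrite !mulrDr; lra.
Qed.

Lemma mixLR_false_alarm eps : 0 < eps -> exists C, forall A B, C < A -> C < B ->
  `|prob 0 (accept1 (mixLR K f X q1) (mixLR K f X q0) A B) - S / B| <= S / B * eps.
Proof.
move=> eps0; have [e [e0 e1 eS]] := small_e _ eps0.
have e10 : 0 < 1 + e by rewrite addr_gt0.
(* The lower estimate uses the level [B / kap l]. The upper one uses the level smaller by [1 + e],
   which [LR_l] reaches as soon as the mixture reaches [B] without being undominated. *)
have [C hC] : exists C, forall B, C < B -> forall l, (l < K)%N ->
   [/\ `|B / kap l * prob 0 (hit l.+1 (ln (B / kap l))) - gam l| <= e,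
       `|B / ((1 + e) * kap l) * prob 0 (hit l.+1 (ln (B / ((1 + e) * kap l)))) - gam l| <= e,
       forall G, (forall t, past t (G t)) ->
        (forall t w, G t w -> B <= mixLR K f X q1 t w) ->
        prob l.+1 (\bigcup_t (G t `&` undominated q1 l.+1 e t)) <= e &
       kap l < B /\ (B * q0 l.+1)^-1 <= e].
  apply: eventually_forall_real => l lt; have lK' := lK _ lt.
  have kl := kap_gt0 _ lt.
  have [C1 h1] := crossing_prob_limit _ _ _ _ lK' kl (limH _ lK') e0.
  have kl' : 0 < (1 + e) * kap l by rewrite mulr_gt0.
  have [C2 h2] := crossing_prob_limit _ _ _ _ lK' kl' (limH _ lK') e0.
  have [C3 h3] := undominated_crossing _ q1P _ _ _ lK' e0 e0.
  exists (Num.max (Num.max C1 C2) (Num.max C3 (Num.max (kap l) (e * q0 l.+1)^-1))) => B.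
  rewrite !gt_max => /andP[/andP[B1 B2] /andP[B3 /andP[B4 B5]]].
  have ql := q0P _ lK'.
  have B0 : 0 < B by exact: lt_trans B4.
  split; [exact: h1|exact: h2|exact: h3|split => //].
  rewrite -[leLHS]mul1r ler_pdivrMr ?mulr_gt0//.
  move: B5; rewrite -[ltLHS]mul1r ltr_pdivrMr ?mulr_gt0// => B5.
  by rewrite ltW// mulrCA.
exists (Num.max C 0) => A B; rewrite !gt_max => /andP[CA A0] /andP[CB B0].
(* The clause on [q0], stated for [B], is used at the threshold [A]. *)
have hA l (lt : (l < K)%N) : (A * q0 l.+1)^-1 <= e by case: (hC A CA l lt) => _ _ _ [].
have {}hC := hC B CB.
have aG := accepted1_adapted _ _ A B (mixLR_past q1) (mixLR_past q0).
rewrite accept1E; set G := accepted1 _ _ _ _ in aG *.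
have GB t w : G t w -> B <= mixLR K f X q1 t w by move=> [].
set M := prob 0 (\bigcup_t G t).
have up : B * M <= S + e * (S + 3 * Q).
  apply: le_trans (mixture_upper _ q1P G B e aG B0 GB) _.
  rewrite -big_split/=.
  apply: (@le_trans _ _ (\sum_(l < K) (q1 l.+1 * gam l + (e * (q1 l.+1 * gam l) + e * (3 * q1 l.+1))))).
    apply: ler_sum => l _; have [_ h2 h3 _] := hC l (ltn_ord l).
    have ql := q1P _ (lK _ (ltn_ord l)); have kl := kap_gt0 _ (ltn_ord l).
    have g0 := gam_gt0 _ (ltn_ord l).
    have kl' : 0 < (1 + e) * kap l by rewrite mulr_gt0.
    have b1 : B * prob 0 (\bigcup_t (G t `&` ~` undominated q1 l.+1 e t)) <=
        (1 + e) * kap l * (gam l + e).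
      apply: (@le_trans _ _ (B * prob 0 (hit l.+1 (ln (B / ((1 + e) * kap l)))))).
        rewrite ler_wpM2l ?(ltW B0)//; apply: prob_mono_ok => //.
        - apply: adapted_measurable; apply: adaptedI => // t; apply: pastC.
          exact: undominated_past.
        - exact: hit_measurable.
        move=> w [[t _ [Gt /undominatedN nu']] okw]; exists t.
        have okt : ok_upto t w by move=> k _; exact: okw.
        apply: le_hit => //; first by rewrite divr_gt0.
        by rewrite ler_pdivrMr// mulrC -mulrA; exact: le_trans (GB _ _ Gt) nu'.
      rewrite -ler_pdivrMl// mulrA [_^-1 * _]mulrC.
      by move: h2; rewrite ler_norml => /andP[_]; lra.
    have b2 : q1 l.+1 / kap l * (B * prob 0 (\bigcup_t (G t `&` ~` undominated q1 l.+1 e t))) <=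
        q1 l.+1 * ((1 + e) * (gam l + e)).
      apply: (@le_trans _ _ (q1 l.+1 / kap l * ((1 + e) * kap l * (gam l + e)))).
        by rewrite ler_wpM2l// divr_ge0 ?ltW.
      by rewrite le_eqVlt; apply/orP; left; apply/eqP; field; rewrite gt_eqF.
    have b3 := ler_wpM2l (ltW ql) (h3 G (fun t => aG.1 t) GB).
    apply: le_trans (lerD b2 b3) _.
    have : q1 l.+1 * (e * e) <= q1 l.+1 * e.
      by rewrite ler_wpM2l ?(ltW ql)// -[leRHS]mulr1 ler_wpM2l ?(ltW e0).
    by rewrite !mulrDl !mulrDr !mul1r; lra.
  rewrite !big_split/= -SE -!mulr_sumr -SE -/Q.
  by rewrite mulrDr.
(* Two of the three errors [e] come from [crossing_decomposition], one from the crossing limit. *)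
have low : S - 3 * (e * Q) <= (1 + e) * (B * M).
  have := mixture_lower _ q1P G B e aG B0 e0 GB.
  move=> /(ler_wpM2l (ltW B0)); rewrite mulrCA => h; rewrite lerBlDr.
  apply: le_trans (lerD h (lexx _)).
  rewrite SE /Q !mulr_sumr -big_split/=; apply: ler_sum => l _.
  have [h1 _ h3 [h4 _]] := hC l (ltn_ord l).
  have ql := q1P _ (lK _ (ltn_ord l)); have kl := kap_gt0 _ (ltn_ord l).
  have hd := crossing_decomposition _ _ _ _ (ltn_ord l) A0 h4 e0 (hA _ (ltn_ord l)) h3 G erefl.
  move: h1; rewrite ler_norml => /andP[h1 _].
  have : gam l <= B / kap l * prob 0 (\bigcup_t (G t `&` ~` undominated q1 l.+1 e t)) + 3 * e.
    by move: hd h1; rewrite /=; lra.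
  move=> /(ler_wpM2l (ltW ql)) h'; apply: le_trans h' _.
  rewrite le_eqVlt; apply/orP; left; apply/eqP; rewrite -/(kap l); field.
  by rewrite gt_eqF.
rewrite -(ler_pM2l B0) -[B in B * `|_|](gtr0_norm B0) -normrM mulrBr.
rewrite [X in _ - X]mulrCA divff ?gt_eqF// mulr1.
rewrite mulrA [B * (S / B)]mulrCA divff ?gt_eqF// mulr1.
rewrite ler_norml; apply/andP; split; last by move: up eS; lra.
rewrite lerBrDr addrC -(ler_pM2l e10).
apply: le_trans low.
have : 0 <= e * (S * eps) by rewrite mulr_ge0 ?(ltW e0)// mulr_ge0 ?ltW.
by move: eS; rewrite !mulrDr !mulrDl !mul1r; lra.
Qed.

End false_alarm_asymptotics.

(** * Log-likelihoods and Kullback-Leibler numbers *)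

Lemma LLR1 i w : LLR f X i 1 w = ln (f i (X 0%N w) / f 0%N (X 0%N w)).
Proof. by rewrite /LLR /LR big_ord1. Qed.

Lemma sum_ln_LR i n w : (i <= K)%N -> ok_upto n w ->
  \sum_(k < n) ln (f i (X k w) / f 0%N (X k w)) = LLR f X i n w.
Proof.
move=> iK okw; rewrite /LLR /LR; apply: expR_inj.
rewrite expR_sum lnK ?posrE; last exact: LR_gt0.
apply: eq_bigr => k _; rewrite lnK// posrE divr_gt0//.
  by rewrite supp// D0//; exact: okw.
by rewrite D0//; exact: okw.
Qed.

(* Gibbs' inequality, from [- ln r >= 1 - r] on [r > 0]. *)
Lemma KL0_ge0 i : (i <= K)%N ->
  (P 0%N).-integrable setT (fun w => (LLR f X i 1 w)%:E) -> 0 <= KL0 P f X i.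
Proof.
move=> iK int.
(* Off [A] the ratio is 0, [ln 0] is 0 by convention and the pointwise bound reads [0 <= 0]; the
   indicator of [A] still has mean 1. *)
pose A := [set w | 0 < LR f X i 1 w].
have pA : past 1 A.
  by apply: past_fun_lt; [exact: past_fun_cst|exact: LR_past].
have mA : measurable A := past_measurable _ _ pA.
have A1 : prob 0 A = 1.
  apply/eqP; rewrite eq_le prob_le1//=.
  have -> : 1 = prob 0 setT by rewrite /prob probability_setT.
  apply: prob_mono_ok => // w [_ okw]; apply: LR_gt0 => // k _; exact: okw.
have [int1 E1] := integrable_LR i 1 setT iK (pastT 1).
have iA : (P 0%N).-integrable setT (fun w => ((\1_A w : R))%:E).
  apply/integrableP; split; first by apply/measurable_EFinP; exact: measurable_indic.
  under eq_integral do rewrite abse_EFin ger0_norm ?indicE//.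
  apply: (@le_lt_trans _ _ (P 0%N A)); last by rewrite probE// ltry.
  by have := integral_indic (P 0%N) measurableT mA; rewrite setIT => <-.
have intN : (P 0%N).-integrable setT (fun w => (- LLR f X i 1 w)%:E).
  by under eq_fun do rewrite EFinN; exact: integrableN.
rewrite /KL0 -lee_fin fineK; last exact: integrable_fin_num.
apply: (@le_trans _ _ (\int[P 0%N]_w ((\1_A w : R)%:E - (LR f X i 1 w * \1_setT w)%:E))%E).
  rewrite integralB// E1.
  have := integral_indic (P 0%N) measurableT mA; rewrite setIT => ->.
  have PA1 : P 0%N A = 1%E by rewrite probE// A1.
  have -> : prob i setT = 1 by rewrite /prob probability_setT.
  by apply: (@le_trans _ _ (P 0%N A - 1)%E) => //; rewrite PA1 subee.
apply: le_integral => //; first exact: integrableB.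
move=> w _; rewrite -EFinB lee_fin indicT mulr1.
have [Aw|nAw] := pselect (A w).
  have -> : \1_A w = 1 :> R by rewrite indicE mem_set.
  have h : -1 < LR f X i 1 w - 1 by rewrite ltrBrDl subrr.
  have := le_ln1Dx h; rewrite addrCA subrr addr0 /LLR; lra.
rewrite indicE memNset// sub0r.
have L0 : LR f X i 1 w = 0.
  by apply/eqP; rewrite eq_le LR_ge0// andbT leNgt; apply/negP.
by rewrite /LLR L0 ln0// !oppr0.
Qed.

(** * Missed detection probabilities *)

Section missed_detection_asymptotics.
Variables (mu : probability R R) (q : nat -> R) (U L : nat -> Omega -> R).
Hypotheses (qP : forall i, (1 <= i <= K)%N -> 0 < q i) (K0 : (1 <= K)%N).
Hypotheses (pU : forall t, past_fun t (U t)) (pL : forall t, past_fun t (L t)).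
Hypothesis qL : forall i t w, (1 <= i <= K)%N -> q i * LR f X i t w <= L t w.
Hypothesis lim : is_limit_overshoot (P 0%N) (lower_overshoot_le (LLR f X 1)) mu.
Hypothesis intZ : forall i, (1 <= i <= K)%N ->
  (P 0%N).-integrable setT (fun w => (LLR f X i 1 w)%:E).

Let acc A B t := accepted0 U L A B t.

Let acc_adapted A B : adapted (acc A B).
Proof. exact: accepted0_adapted. Qed.

Let acc_LR A B i t w : (1 <= i <= K)%N -> 0 < A -> acc A B t w ->
  A * q i * LR f X i t w <= 1.
Proof.
move=> iK A0 /accepted0_le[_ LA]; rewrite -mulrA -ler_pdivlMl// mulr1.
exact: le_trans (qL _ _ _ iK) LA.
Qed.

Let lower_overshootE c x :
  lower_overshoot_le (LLR f X 1) c x = upper_overshoot_le (fun t w => - LLR f X 1 t w) c x.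
Proof.
apply/seteqP; split => w [t [Zc [H Zx]]]; exists t; split.
- by lra.
- split; first by move=> s st; have := H s st; lra.
  by move: Zx; rewrite ler0_norm; lra.
- by lra.
- split; first by move=> s st; have := H s st; lra.
  by rewrite ler0_norm; lra.
Qed.

(** Acceptance of [H_0] makes [- Z^1] cross [ln (q 1 * A)]. As [LR_0 = expR (- Z^1) * LR_1], the
    crossing limit applies with the null and the alternative exchanged. *)
Let first_hypothesis e : 0 < e -> exists C, forall A B, C < A ->
  prob 1 (accept0 U L A B) <= (overshoot_const mu + e) / (q 1%N * A).
Proof.
move=> e0; have q10 : 0 < q 1%N by apply: qP; rewrite K0.
have lim' : is_limit_overshoot (P 0%N)
    (upper_overshoot_le (fun t w => - LLR f X 1 t w)) mu.
  case: lim => m0 h; split => // x x0.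
  by under eq_fun do rewrite -lower_overshootE; exact: h.
have pS t : past_fun t (fun w => - LLR f X 1 t w).
  apply: (past_fun_comp _ (fun x => - x) (LLR f X 1 t)); last exact: LLR_past.
  exact: oppr_measurable.
have LS t w : ok_upto t w -> LR f X 0 t w = expR (- LLR f X 1 t w) * LR f X 1 t w.
  move=> okw; have L0 : 0 < LR f X 1 t w by exact: LR_gt0.
  by rewrite expRN /LLR lnK ?posrE// mulVf ?LR_0// gt_eqF.
have [C hC] := overshoot_limit 0 1 _ (leq0n K) K0 pS LS mu lim' e e0.
exists (expR C / q 1%N) => A B CA.
have A0 : 0 < A by apply: lt_trans CA; rewrite divr_gt0 ?expR_gt0.
have qA : 0 < q 1%N * A by rewrite mulr_gt0.
have Cc : C < ln (q 1%N * A).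
  by rewrite -ltr_expR lnK ?posrE// mulrC -ltr_pdivrMr.
have := hC _ Cc; rewrite lnK ?posrE// ler_norml => /andP[_ h].
rewrite ler_pdivlMr// mulrC.
apply: (@le_trans _ _ (q 1%N * A * prob 1 [set w | exists t, ln (q 1%N * A) <= - LLR f X 1 t w])).
  rewrite ler_wpM2l ?(ltW qA)// accept0E; apply: prob_mono_ok => //.
  - exact: adapted_measurable (acc_adapted A B).
  - rewrite -bigcup_crossing; apply: adapted_measurable; exact: crossing_adapted.
  move=> w [[t _ At] okw]; exists t.
  have okt : ok_upto t w by move=> k _; exact: okw.
  have LR0 : 0 < LR f X 1 t w by exact: LR_gt0.
  rewrite lerNr /LLR -lnV ?posrE// ler_ln ?posrE ?invr_gt0//.
  have K1 : (1 <= 1 <= K)%N by rewrite K0.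
  have h1 := acc_LR A B 1 t w K1 A0 At.
  by rewrite -[leRHS]mul1r ler_pdivlMr// mulrC [q 1%N * A]mulrC.
by move: h; lra.
Qed.

Let other_bound A B i n dl : (1 <= i <= K)%N -> 0 < A -> 0 < dl ->
  A * q i * prob i (\bigcup_t acc A B t) <=
    prob 0 [set w | LR f X 1 n w <= (dl * A)^-1] + dl / q 1%N + q i * dl +
    prob 0 [set w | dl / A <= LR f X i n w].
Proof.
move=> iK A0 dl0; have K1 : (1 <= 1 <= K)%N by rewrite K0.
have iK' : (i <= K)%N by case/andP: iK.
have q10 : 0 < q 1%N := qP _ K1; have qi0 := qP _ iK.
have aG := acc_adapted A B.
pose E t := acc A B t `&` [set _ | (t < n)%N].
have aE : adapted E by apply: adaptedI => // t; exact: past_prop.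
pose V := [set w | dl / A <= LR f X i n w].
have pV : past n V by apply: past_fun_le; [exact: past_fun_cst|exact: LR_past].
pose F t := acc A B t `&` [set w | (n <= t)%N /\ V w].
have aF : adapted F.
  apply: adaptedI => // t; have [nt|tn] := leqP n t.
    rewrite (_ : [set w | _] = V); first exact: past_mono nt pV.
    by apply/seteqP; split => w //= [].
  rewrite (_ : [set w | _] = set0); first exact: past0.
  by apply/seteqP; split => w //= -[].
have mE := adapted_measurable _ aE.
have mF := adapted_measurable _ aF.
have mV := past_measurable _ _ pV.
have mG := adapted_measurable _ aG.
have split_le : prob i (\bigcup_t acc A B t) <=
    prob i (\bigcup_t E t) + prob i (~` V) + prob i (\bigcup_t F t).
  apply: le_trans (_ : _ <= _) (lerD (prob_leU _ _ _ mE (measurableC mV)) (lexx _)).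
  apply: le_trans (prob_leU _ _ _ (measurableU _ _ mE (measurableC mV)) mF).
  apply: prob_le => //; first by do 2 apply: measurableU => //; exact: measurableC.
  move=> w [t _ At]; have [tn|nt] := ltnP t n; first by left; left; exists t.
  have [Vw|nV] := pselect (V w); first by right; exists t.
  by left; right.
have b1 j : (1 <= j <= K)%N -> A * q j * prob j (\bigcup_t E t) <= prob 0 (\bigcup_t E t).
  move=> jK; rewrite -[leRHS]mul1r; apply: compare_prob => //; first by case/andP: jK.
  by move=> t w okw [At _]; rewrite LR_0// mulr1; exact: acc_LR At.
have b2 : prob i (~` V) <= dl / A.
  apply: (@le_trans _ _ (dl / A * prob 0 (~` V))).
    rewrite -[leLHS]mul1r; apply: (compare_prob_at _ _ _ _ n) => //; first exact: pastC.
    by move=> w okw /negP; rewrite -ltNge LR_0// mul1r mulr1 => /ltW.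
  rewrite -[leRHS]mulr1; apply: ler_wpM2l; first by rewrite divr_ge0// ltW.
  by apply: prob_le1; exact: measurableC.
have b3 : A * q i * prob i (\bigcup_t F t) <= prob 0 V.
  apply: (@le_trans _ _ (1 * prob 0 (\bigcup_t F t))).
    apply: compare_prob => // t w okw [At _].
    by rewrite LR_0// mulr1; exact: acc_LR At.
  by rewrite mul1r; apply: prob_le => // w [t _ [_ []]].
pose W := [set w | LR f X 1 n w <= (dl * A)^-1].
have pW : past n W by apply: past_fun_le; [exact: LR_past|exact: past_fun_cst].
have mW := past_measurable _ _ pW.
have b4 : prob 0 (\bigcup_t E t) <= prob 0 W + dl / q 1%N.
  have pE : past n (\bigcup_t E t).
    apply: past_bigcup => t; have [tn|nt] := ltnP t n.
      by apply: (past_mono t n _ (ltnW tn)); case: aE.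
    rewrite (_ : E t = set0); first exact: past0.
    by apply/seteqP; split => w // -[_ /=]; rewrite ltnNge nt.
  pose Z := (\bigcup_t E t) `\` W.
  have pZ : past n Z by exact: pastD.
  have mZ := past_measurable _ _ pZ.
  apply: (@le_trans _ _ (prob 0 W + prob 0 Z)).
    apply: le_trans (prob_leU _ _ _ mW mZ).
    apply: prob_le => //; first exact: measurableU.
    by move=> w Ew; have [Ww|nW] := pselect (W w); [left|right].
  rewrite lerD2l ler_pdivlMr// mulrC.
  have z1 : prob 0 Z <= dl * A * prob 1 (\bigcup_t E t).
    apply: (@le_trans _ _ (dl * A * prob 1 Z)).
      rewrite -[leLHS]mul1r; apply: (compare_prob_at _ _ _ _ n) => //.
      move=> w okw [_ /negP]; rewrite -ltNge LR_0// mulr1.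
      by rewrite -[ltLHS]mul1r ltr_pdivrMr ?mulr_gt0// mulrC => /ltW.
    apply: ler_wpM2l; first by rewrite mulr_ge0// ltW.
    by apply: prob_le => // w [].
  have z2 := b1 1%N K1.
  have z3 : prob 0 (\bigcup_t E t) <= 1 by exact: prob_le1.
  have z4 : A * q 1%N * prob 1 (\bigcup_t E t) <= 1 by exact: le_trans z3.
  have := ler_wpM2l (ltW dl0) z4; rewrite mulr1; apply: le_trans.
  apply: le_trans (ler_wpM2l (ltW q10) z1) _.
  by rewrite le_eqVlt; apply/orP; left; apply/eqP; ring.
have Aq : 0 < A * q i by rewrite mulr_gt0.
apply: le_trans (ler_wpM2l (ltW Aq) split_le) _.
rewrite !mulrDr.
have := ler_wpM2l (ltW Aq) b2.
have -> : A * q i * (dl / A) = q i * dl by field; rewrite gt_eqF.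
have := b1 i iK; move: b3 b4; rewrite -/W -/V; lra.
Qed.

Let KL0E j : (1 <= j <= K)%N ->
  KL0 P f X j = - fine (\int[P 0%N]_w (LLR f X j 1 w)%:E).
Proof.
move=> jK; rewrite /KL0 -fineN -integralN; last exact: integrable_add_def (intZ _ jK).
by congr fine; apply: eq_integral => w _; rewrite EFinN.
Qed.

Let other_hypotheses i e : (1 <= i <= K)%N -> KL0 P f X 1 < KL0 P f X i -> 0 < e ->
  exists C, forall A B, C < A -> A * q i * prob i (accept0 U L A B) <= e.
Proof.
move=> iK I1i e0; have K1 : (1 <= 1 <= K)%N by rewrite K0.
have iK' : (i <= K)%N by case/andP: iK.
have q10 : 0 < q 1%N := qP _ K1; have qi0 := qP _ iK.
(* Nonnegativity here and the strict gap make [m] positive, so that [n] grows with [A]. *)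
have I10 := KL0_ge0 1 K0 (intZ _ K1).
(* The midpoint and a quarter of the gap: [m - g = I_1 + g] and [m + g = I_i - g], so each weak law
   has a margin [g] and [n * g] is left to absorb constants. *)
pose m := (KL0 P f X 1 + KL0 P f X i) / 2.
pose g := (KL0 P f X i - KL0 P f X 1) / 4.
have g0 : 0 < g by rewrite divr_gt0// subr_gt0.
have m0 : 0 < m by rewrite divr_gt0// ltr_wpDl// (le_lt_trans I10).
pose hl j (x : T) := ln (f j x / f 0%N x).
have mhl j : (j <= K)%N -> measurable_fun setT (hl j).
  by move=> jK; exact: measurableT_comp (@measurable_ln R) (measurable_lr j jK).
have hlE j w : hl j (X 0%N w) = LLR f X j 1 w by rewrite LLR1.
have KLE j : (1 <= j <= K)%N -> fine (\int[P 0%N]_w (hl j (X 0%N w))%:E) = - KL0 P f X j.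
  move=> jK; rewrite (KL0E _ jK) opprK.
  by congr fine; apply: eq_integral => w _; rewrite hlE.
have e4 : 0 < e / 4 by rewrite divr_gt0.
have [n1 hn1] : exists n0 : nat, forall n, (n0 <= n)%N ->
    prob 0 [set w | n%:R * (m - g) <= \sum_(k < n) - hl 1%N (X k w)] <= e / 4.
  apply: (weak_law_upper 0 (fun x => - hl 1%N x) (leq0n K)) => //.
  - exact: measurableT_comp (mhl 1%N K0).
  - under eq_fun do rewrite EFinN hlE; apply: integrableN; exact: intZ.
  - under eq_integral do rewrite EFinN.
    rewrite (_ : (\int[P 0%N]_w (- (hl 1%N (X 0%N w))%:E))%E = (KL0 P f X 1)%:E).
      by rewrite /= /m /g; lra.
    rewrite /KL0 fineK.
      by apply: eq_integral => w _; rewrite hlE EFinN.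
    apply: integrable_fin_num => //.
    by under eq_fun do rewrite EFinN; apply: integrableN; exact: intZ.
have [n2 hn2] : exists n0 : nat, forall n, (n0 <= n)%N ->
    prob 0 [set w | n%:R * - (m + g) <= \sum_(k < n) hl i (X k w)] <= e / 4.
  apply: (weak_law_upper 0 (hl i) (leq0n K)) => //.
  - exact: mhl.
  - under eq_fun do rewrite hlE; exact: intZ.
  - by rewrite KLE// /m /g; lra.
(* Chosen so that the two terms of [other_bound] linear in [dl] add up to [e / 2]. *)
pose dl := (e / 2) / (1 / q 1%N + q i).
have w0 : 0 < 1 / q 1%N + q i by rewrite addr_gt0// divr_gt0.
have dl0 : 0 < dl by rewrite divr_gt0// divr_gt0.
have dlE : dl / q 1%N + q i * dl = e / 2.
  have -> : dl / q 1%N + q i * dl = dl * (1 / q 1%N + q i) by ring.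
  by rewrite /dl divfK// gt_eqF.
(* Makes [n * g] exceed [m - ln dl]: the [m] pays for rounding [ln A / m] down to an integer, the
   [ln dl] for the factor [dl] in the two levels. *)
pose n3 := (Num.truncn (`|m - ln dl| / g)).+1.
pose n0 := maxn (maxn n1 n2) n3.
exists (expR (m * n0%:R)) => A B CA.
have A0 : 0 < A by apply: lt_trans CA; exact: expR_gt0.
have lnA : m * n0%:R < ln A by rewrite -ltr_expR lnK.
pose n := Num.truncn (ln A / m).
have lnm : 0 <= ln A / m.
  by rewrite divr_ge0 ?(ltW m0)// (le_trans _ (ltW lnA))// mulr_ge0// ltW.
have /andP[nm1 nm2] := truncn_itv lnm.
have n0n : (n0 <= n)%N.
  rewrite -ltnS -(ltr_nat R); apply: le_lt_trans nm2.
  by rewrite ler_pdivlMr// mulrC ltW.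
have [n1n n2n n3n] : [/\ (n1 <= n)%N, (n2 <= n)%N & (n3 <= n)%N].
  by move: n0n; rewrite /n0 !geq_max => /andP[/andP[-> ->] ->].
have ng : m - ln dl <= n%:R * g.
  apply: (@le_trans _ _ (n3%:R * g)); last by rewrite ler_wpM2r ?ler_nat// ltW.
  apply: (le_trans (ler_norm _)); rewrite -ler_pdivrMr// ltW//; exact: truncnS_gt.
have nm1' : n%:R * m <= ln A by move: nm1; rewrite ler_pdivlMr.
have nm2' : ln A <= n%:R * m + m.
  by move: nm2; rewrite ltr_pdivrMr// -natr1 mulrDl mul1r => /ltW.
rewrite accept0E; apply: le_trans (other_bound A B i n dl iK A0 dl0) _.
have mle c (Y : Omega -> R) : measurable_fun setT Y -> measurable [set w | c <= Y w].
  by move=> mY; rewrite -[X in measurable X]setTI; exact: measurable_fun_le.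
have mh j k : (j <= K)%N -> measurable_fun setT (hl j \o X k).
  by move=> jK; exact: measurableT_comp (mhl j jK) (mX k).
have w1 : prob 0 [set w | LR f X 1 n w <= (dl * A)^-1] <= e / 4.
  apply: le_trans (hn1 n n1n); apply: prob_mono_ok => //.
  - by apply: (past_measurable n); apply: past_fun_le; [exact: LR_past|exact: past_fun_cst].
  - apply: mle; apply: measurable_sum => k; apply: measurableT_comp => //; exact: mh.
  move=> w [/= LRle okw]; have okn : ok_upto n w by move=> k _; exact: okw.
  rewrite sumrN (sum_ln_LR 1)// lerNr /LLR.
  have : ln (LR f X 1 n w) <= ln (dl * A)^-1.
    have Ln0 : 0 < LR f X 1 n w by exact: LR_gt0.
    have dA0 : 0 < (dl * A)^-1 by rewrite invr_gt0 mulr_gt0.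
    by rewrite ler_ln ?posrE.
  have dlA : 0 < dl * A by rewrite mulr_gt0.
  have -> : ln (dl * A)^-1 = - (ln dl + ln A).
    by rewrite lnV ?posrE//; congr (- _); rewrite lnM ?posrE.
  by move: ng nm1'; rewrite mulrBr; lra.
have w3 : prob 0 [set w | dl / A <= LR f X i n w] <= e / 4.
  apply: le_trans (hn2 n n2n); apply: prob_mono_ok => //.
  - by apply: (past_measurable n); apply: past_fun_le; [exact: past_fun_cst|exact: LR_past].
  - by apply: mle; apply: measurable_sum => k; exact: mh.
  move=> w [/= LRge okw]; have okn : ok_upto n w by move=> k _; exact: okw.
  rewrite (sum_ln_LR i)// /LLR.
  have : ln (dl / A) <= ln (LR f X i n w).
    have Ln0 : 0 < LR f X i n w by exact: LR_gt0.
    have dA0 : 0 < dl / A by exact: divr_gt0.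
    by rewrite ler_ln ?posrE.
  rewrite ln_div ?posrE//.
  by move: ng nm2'; rewrite mulrN mulrDr; lra.
by move: w1 w3 dlE; lra.
Qed.

(** For [i] other than 1 the normalized probability tends to 0, and positivity of the overshoot
    constant turns that into the stated bound; for [i = 1] the constant is the crossing limit
    itself. *)
Lemma missed_detection_asymptotics i eps : (1 <= i <= K)%N ->
  (forall j, (2 <= j <= K)%N -> KL0 P f X 1 < KL0 P f X j) -> 0 < eps ->
  exists C, forall A B, C < A ->
    prob i (accept0 U L A B) <= overshoot_const mu / (q i * A) * (1 + eps).
Proof.
move=> iK sepI eps0.
have gam0 : 0 < overshoot_const mu by apply: overshoot_const_gt0; case: lim.
have e0 : 0 < overshoot_const mu * eps by rewrite mulr_gt0.
have [i1|i1] := eqVneq i 1%N.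
  have [C hC] := first_hypothesis _ e0; exists C => A B CA.
  rewrite i1; apply: le_trans (hC A B CA) _.
  by rewrite mulrDl mulrDr mulr1 [X in _ + X]mulrAC.
have iK2 : (2 <= i <= K)%N.
  by case/andP: iK => i0 ->; rewrite andbT ltn_neqAle eq_sym i1.
have [C hC] := other_hypotheses _ _ iK (sepI _ iK2) e0.
exists (Num.max C 0) => A B; rewrite gt_max => /andP[CA A0].
have qi0 := qP _ iK.
rewrite mulrAC ler_pdivlMr ?mulr_gt0// mulrC [q i * A]mulrC.
by apply: le_trans (hC A B CA) _; rewrite mulrDr mulr1 lerDr ltW.
Qed.

End missed_detection_asymptotics.

End change_of_measure.

(** * A common set of full measure for all the densities *)

Section good_points.
Context {R : realType} {d : nat}.
Variables (nu : {measure set Rd R d -> \bar R}) (K : nat) (f : nat -> Rd R d -> R).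
Hypothesis dens : forall j, (j <= K)%N -> is_density nu (f j).
Hypothesis supp : forall j x, (j <= K)%N -> (0 < f j x) = (0 < f 0%N x).

(* The support, minus the points where two nu-a.e. equal densities differ. *)
Definition good_points : set (Rd R d) :=
  [set x | 0 < f 0%N x /\ forall i j, (i <= K)%N -> (j <= K)%N ->
     nu [set y | f i y != f j y] = 0%E -> f i x = f j x].

Let mf i : (i <= K)%N -> measurable_fun setT (f i).
Proof. by move=> iK; case: (dens i iK) => _ []. Qed.

Let bad i j : set (Rd R d) :=
  if [&& (i <= K)%N, (j <= K)%N & nu [set y | f i y != f j y] == 0%E]
  then [set y | f i y != f j y] else set0.

Let bad_measurable i j : measurable (bad i j).
Proof.
by rewrite /bad; case: ifP => // /and3P[iK jK _]; apply: measurable_neq; exact: mf.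
Qed.

Let bad_null i j : nu (bad i j) = 0%E.
Proof. by rewrite /bad; case: ifP => [/and3P[_ _ /eqP]|_]. Qed.

Let mbad : measurable (\bigcup_i \bigcup_j bad i j).
Proof. by do 2 apply: bigcupT_measurable => ?. Qed.

Let good_pointsE :
  good_points = [set x | 0 < f 0%N x] `\` \bigcup_i \bigcup_j bad i j.
Proof.
apply/seteqP; split => x.
  move=> [f0 eqf]; split => // -[i _ [j _]]; rewrite /bad.
  by case: ifP => // /and3P[iK jK /eqP n0] /=; rewrite (eqf i j)// eqxx.
move=> [f0 nbad]; split => // i j iK jK n0; apply/eqP; apply: contrapT => /negP ne.
by apply: nbad; exists i => //; exists j => //; rewrite /bad iK jK n0 eqxx.
Qed.

Lemma good_points_measurable : measurable good_points.
Proof.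
rewrite good_pointsE; apply: measurableD => //.
rewrite (_ : [set x | _] = ~` [set x | f 0%N x <= 0]).
  apply: measurableC; rewrite -[X in measurable X]setTI.
  by apply: measurable_fun_le => //; exact: mf.
by apply/seteqP; split => x /=; rewrite ltNge => /negP.
Qed.

(** A point outside the set lies in a countable union of null sets, or [f 0] vanishes there and, by
    common support, so does [f j]. *)
Lemma good_points_full j : (j <= K)%N -> (\int[nu]_(x in ~` good_points) (f j x)%:E = 0)%E.
Proof.
move=> jK; have mg := measurableC good_points_measurable.
have [fj0 _] := dens j jK.
rewrite integral_mkcond -(integral0 nu setT); apply: ae_eq_integral => //.
  apply/(measurable_restrictT _ mg); apply: measurable_funTS.
  by apply/measurable_EFinP; exact: mf.
exists (\bigcup_i \bigcup_j bad i j); split => //.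
  apply: measure_negligible => //.
  apply: negligible_bigcup => i; apply: negligible_bigcup => l.
  by apply/negligibleP => //; exact: bad_null.
move=> x /= nx; apply: contrapT => nbad; apply: nx => _.
rewrite patchE; case: ifPn => // /set_mem ng.
have : ~ (0 < f 0%N x) by move=> f0; apply: ng; rewrite good_pointsE; split.
rewrite -(supp j)// => /negP; rewrite -leNgt => fj.
by congr EFin; apply/eqP; rewrite eq_le fj fj0.
Qed.

End good_points.

Theorem theorem1 (R : realType) (d : nat) (dO : measure_display) (Omega : measurableType dO)
  (nu : {measure set Rd R d -> \bar R}) (K : nat) (f : nat -> Rd R d -> R)
  (P : nat -> probability Omega R) (X : nat -> Omega -> Rd R d)
  (H : nat -> probability R R) (H0 : nat -> probability R R) :
  (* nu: non-degenerate sigma-finite measure *)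
  sigma_finite setT nu -> (0 < nu setT)%E ->
  (1 <= K)%N ->
  (* f_0, ..., f_K are densities with common support *)
  (forall j, (j <= K)%N -> is_density nu (f j)) ->
  (forall j x, (j <= K)%N -> (0 < f j x) = (0 < f 0%N x)) ->
  (* under P_j the X_n are i.i.d. with density f_j *)
  (forall j, (j <= K)%N -> iid_density nu (P j) X (f j)) ->
  (* standing assumptions *)
  (forall i, (1 <= i <= K)%N -> (0 < nu [set x | f i x != f 0%N x])%E) ->
  (forall i, (1 <= i <= K)%N ->
     nonarithmetic (P 0%N) (LLR f X i 1) /\ nonarithmetic (P i) (LLR f X i 1)) ->
  (forall i, (1 <= i <= K)%N ->
     (P i).-integrable setT (fun w => (LLR f X i 1 w)%:E) /\
     (P 0%N).-integrable setT (fun w => (LLR f X i 1 w)%:E)) ->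
  (* ordering I^1_0 <= I^2_0 <= ... <= I^K_0 *)
  (forall i j, (1 <= i)%N -> (i <= j)%N -> (j <= K)%N -> KL0 P f X i <= KL0 P f X j) ->
  (* limiting overshoot distributions H_i and H^i_0 *)
  (forall i, (1 <= i <= K)%N ->
     is_limit_overshoot (P i) (upper_overshoot_le (LLR f X i)) (H i)) ->
  (forall i, (1 <= i <= K)%N ->
     is_limit_overshoot (P 0%N) (lower_overshoot_le (LLR f X i)) (H0 i)) ->
  (* (a) *)
  (forall (A B : R) (q0 q1 : nat -> R), 1 < A -> 1 < B ->
     (forall i, (1 <= i <= K)%N -> 0 < q0 i) -> (forall i, (1 <= i <= K)%N -> 0 < q1 i) ->
     (P 0%N (accept1 (mixLR K f X q1) (mixLR K f X q0) A B) <= (wnorm K q1 / B)%:E)%E /\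
     (P 0%N (accept1 (maxLR K f X q1) (maxLR K f X q0) A B) <= (wnorm K q1 / B)%:E)%E /\
     (forall i, (1 <= i <= K)%N ->
        (P i (accept0 (mixLR K f X q1) (mixLR K f X q0) A B) <= ((A * q0 i)^-1)%:E)%E /\
        (P i (accept0 (maxLR K f X q1) (maxLR K f X q0) A B) <= ((A * q0 i)^-1)%:E)%E)) /\
  (* (b) *)
  (forall (q0 q1 : nat -> R),
     (forall i, (1 <= i <= K)%N -> 0 < q0 i) -> (forall i, (1 <= i <= K)%N -> 0 < q1 i) ->
     let S := \sum_(1 <= j < K.+1) q1 j * overshoot_const (H j) in
     (forall eps : R, 0 < eps -> exists C : R, forall A B : R, C < A -> C < B ->
        `| fine (P 0%N (accept1 (mixLR K f X q1) (mixLR K f X q0) A B)) - S / B |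
          <= S / B * eps) /\
     (forall eps : R, 0 < eps -> exists C : R, forall A B : R, C < A -> C < B ->
        fine (P 0%N (accept1 (maxLR K f X q1) (maxLR K f X q0) A B)) <= S / B * (1 + eps)) /\
     (* if in addition r = 1 *)
     ((forall j, (2 <= j <= K)%N -> KL0 P f X 1 < KL0 P f X j) ->
      forall i, (1 <= i <= K)%N ->
      forall eps : R, 0 < eps -> exists C : R, forall A B : R, C < A -> C < B ->
        fine (P i (accept0 (mixLR K f X q1) (mixLR K f X q0) A B))
          <= overshoot_const (H0 1%N) / (q0 i * A) * (1 + eps) /\
        fine (P i (accept0 (maxLR K f X q1) (maxLR K f X q0) A B))
          <= overshoot_const (H0 1%N) / (q0 i * A) * (1 + eps))).
Proof.
move=> _ _ K1 dens supp iidX _ _ intZ _ limH limH0.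
have mD := good_points_measurable nu K f dens.
have Dnull := good_points_full nu K f dens supp.
have D0 x : good_points nu K f x -> 0 < f 0%N x by case.
have Deq i j x : (i <= K)%N -> (j <= K)%N ->
    nu [set x | f i x != f j x] = 0%E -> good_points nu K f x -> f i x = f j x.
  by move=> iK jK n0 [_]; exact.
have mix_past q t : past_fun X t (mixLR K f X q t) := mixLR_past nu K f X dens q t.
have max_past q t : past_fun X t (maxLR K f X q t) := maxLR_past nu K f X dens q t.
have lift i (A : set Omega) (c : R) : measurable A -> fine (P i A) <= c -> (P i A <= c%:E)%E.
  by move=> mA h; rewrite -(fineK (fin_num_measure (P i) A mA)) lee_fin.
have m1 U L A B : (forall t, past_fun X t (U t)) -> (forall t, past_fun X t (L t)) ->
    measurable (accept1 U L A B).
  move=> pU pL; rewrite accept1E; apply: (adapted_measurable nu K f P X iidX).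
  exact: accepted1_adapted.
have m0 U L A B : (forall t, past_fun X t (U t)) -> (forall t, past_fun X t (L t)) ->
    measurable (accept0 U L A B).
  move=> pU pL; rewrite accept0E; apply: (adapted_measurable nu K f P X iidX).
  exact: accepted0_adapted.
split.
- move=> A B q0 q1 A1 B1 q0P q1P.
  have A0 : 0 < A by exact: lt_trans A1.
  have B0 : 0 < B by exact: lt_trans B1.
  split.
    apply: lift; first exact: m1.
    exact: (false_alarm_le nu K f P X dens supp iidX _ mD D0 Dnull).
  split.
    apply: lift; first exact: m1.
    apply: (false_alarm_le nu K f P X dens supp iidX _ mD D0 Dnull) => // t w.
    exact: (maxLR_le_mixLR nu K f X dens).
  move=> i iK; split; (apply: lift; first exact: m0);
    apply: (missed_detection_le nu K f P X dens supp iidX _ mD D0 Dnull) => //;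
    try exact: q0P; move=> t w.
    exact: (le_mixLR nu K f X dens).
  exact: le_maxLR.
- move=> q0 q1 q0P q1P S; split; [|split].
  + by move=> eps eps0; apply: (mixLR_false_alarm nu K f P X dens supp iidX _ mD D0 Dnull Deq).
  + by move=> eps eps0; apply: (maxLR_false_alarm nu K f P X dens supp iidX _ mD D0 Dnull).
  move=> sepI i iK eps eps0.
  have K11 : (1 <= 1 <= K)%N by rewrite K1.
  have intZ0 j : (1 <= j <= K)%N ->
      (P 0%N).-integrable setT (fun w => (LLR f X j 1 w)%:E).
    by move=> jK; case: (intZ j jK).
  (* For missed detection the two tests differ only in [U] and [L]; one bound serves both. *)
  have HUL U L : (forall t, past_fun X t (U t)) -> (forall t, past_fun X t (L t)) ->
      (forall i t w, (1 <= i <= K)%N -> q0 i * LR f X i t w <= L t w) ->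
      exists C, forall A B, C < A ->
        fine (P i (accept0 U L A B)) <= overshoot_const (H0 1%N) / (q0 i * A) * (1 + eps).
    move=> pU pL qL.
    exact: (missed_detection_asymptotics nu K f P X dens supp iidX _ mD D0 Dnull
      _ _ _ _ q0P K1 pU pL qL (limH0 1%N K11) intZ0).
  have [C1 h1] := HUL _ _ (mix_past q1) (mix_past q0)
    (fun i t w iK => le_mixLR nu K f X dens q0 q0P i t w iK).
  have [C2 h2] := HUL _ _ (max_past q1) (max_past q0)
    (fun i t w iK => le_maxLR K f X q0 i t w iK).
  exists (Num.max C1 C2) => A B; rewrite gt_max => /andP[A1 A2] _.
  by split; [exact: h1|exact: h2].
Qed.
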